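(* Let $s(t)$ denote the minimum number of vertices of a (finite, simple) graph $G$ with $\mathrm{gap}(G)=t$. Then $s(1)=5$, $s(2)=10$, $s(3)=13$ and $s(4)=17$.
   Context: For a graph $G$, $\theta(G)$ denotes the minimum number of cliques needed to cover $V(G)$, $\alpha(G)$ denotes the maximum size of a stable set of $G$, and the gap of $G$ is $\mathrm{gap}(G)=\theta(G)-\alpha(G)$. *)

(* Defs.v *)
From HB Require Import structures.
From mathcomp Require Import all_boot all_order all_algebra.

Set Implicit Arguments.
Unset Strict Implicit.
Unset Printing Implicit Defensive.

Record sgraph := SGraph {
  vertex :> finType;
  edge : rel vertex;
  edge_sym : symmetric edge;
  edge_irr : irreflexive edge
}.

Definition is_clique (G : sgraph) (K : {set G}) : bool :=
  [forall x in K, forall y in K, (x != y) ==> edge x y].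

Definition is_stable (G : sgraph) (A : {set G}) : bool :=
  [forall x in A, forall y in A, ~~ edge x y].

Definition alpha (G : sgraph) : nat :=
  \max_(A : {set G} | is_stable A) #|A|.

Definition is_clique_cover (G : sgraph) (C : {set {set G}}) : bool :=
  [forall K in C, is_clique K] && (cover C == [set: G]).

Definition coverable (G : sgraph) (k : nat) : bool :=
  [exists C : {set {set G}}, is_clique_cover C && (#|C| == k)].

Lemma coverable_ex (G : sgraph) : exists k, coverable G k.
Proof.
pose C := [set [set x] | x : G]; exists #|C|.
apply/existsP; exists C; rewrite eqxx andbT; apply/andP; split.
  apply/forall_inP => K /imsetP[x _ ->].
  apply/forall_inP => y /set1P->; apply/forall_inP => z /set1P->.
  by rewrite eqxx.
apply/eqP/setP => x; rewrite in_setT; apply/bigcupP.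
by exists [set x]; [apply: imset_f | apply: set11].
Qed.

Definition theta (G : sgraph) : nat := ex_minn (coverable_ex G).

Definition gap (G : sgraph) : int := ((theta G)%:Z - (alpha G)%:Z)%R.

(* [is_s t n] is the relational form of s(t) = n: the minimum of the orders of
   the graphs of gap t exists and equals n. *)
Definition is_s (t n : nat) : Prop :=
  (exists2 G : sgraph, gap G = Posz t & #|G| = n) /\
  (forall G : sgraph, gap G = Posz t -> n <= #|G|).

(* Main.v *)
(** A graph that is minimal for its gap, connected and triangle-free is
factor-critical by Gallai's lemma, so its clique cover number is (n + 1) / 2 and
the bounds R(3,3) <= 6, R(3,4) <= 9, R(3,5) <= 14 limit its gap.  Deleting a
triangle lowers the gap by at most one.  This reduces the lower bounds to graphs
that consist of a clique, a 5-hole and few further vertices, where the clique can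
be absorbed by a cover of the rest, and to two exceptional situations: gap two
on 10 vertices, which forces two disjoint 5-holes, and gap four on 16 vertices,
where any two triangles would meet although any 14 vertices contain a triangle.
The upper bounds come from C5, 2 C5 and Ramsey graphs for R(3,5) and R(3,6). *)
Require Import Defs.
From mathcomp Require Import all_boot all_order all_algebra zify.

Set Implicit Arguments.
Unset Strict Implicit.
Unset Printing Implicit Defensive.

(** * Clique cover number and stability number of vertex subsets *)

Section Subsets.

Variable G : sgraph.
Implicit Types (A B K S U : {set G}) (x y z : G) (k n t : nat).

Notation e := (@edge G).

(** Everything takes place on vertex subsets of one fixed graph, and gap equal to t is replaced by
    gap greater than t ([excess t]): this passes to inclusion-minimal subsets, and deleting a clique
    turns [excess t.+1] into [excess t]. The arithmetic of triangle deletion decides where the work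
    lies. For gap 3 the count suffices, since 12 - 3 = 9 vertices cannot have gap 2. Elsewhere the
    deletion ends on sets where the smaller gap does occur: 5 to 7 vertices with gap 1, 10 with gap
    2, 13 with gap 3. Such sets have to be described: a 5-hole with at most two further vertices,
    two separate 5-holes, a triangle-free graph. The description on 10 vertices is the hardest;
    there a triangle is excluded separately for stability number 2, at least 4, and 3. For
    triangle-free sets the equation 2 theta = n + 1 leaves only odd n, and alpha < theta - t
    collides with a Ramsey bound at n = 9, 11, 15 for t = 1, 2, 3. *)

Fixpoint covered k A : bool :=
  if k is k'.+1 then [exists K, is_clique K && covered k' (A :\: K)]
  else A == set0.

Lemma cliqueP K :
  reflect {in K &, forall x y, x != y -> e x y} (is_clique K).
Proof.
apply: (iffP forall_inP) => [H x y xK yK nxy | H x xK].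
  by have /forall_inP/(_ _ yK)/implyP/(_ nxy) := H _ xK.
by apply/forall_inP => y yK; apply/implyP => nxy; apply: H.
Qed.

Lemma stableP A : reflect {in A &, forall x y, ~~ e x y} (is_stable A).
Proof.
apply: (iffP forall_inP) => [H x y xA yA | H x xA].
  by have /forall_inP/(_ _ yA) := H _ xA.
by apply/forall_inP => y yA; apply: H.
Qed.

Lemma cliqueS K B : B \subset K -> is_clique K -> is_clique B.
Proof.
by move=> /subsetP sBK /cliqueP cK; apply/cliqueP => x y /sBK xK /sBK; apply: cK.
Qed.

Lemma clique1 x : is_clique [set x].
Proof. by apply/cliqueP => y z /set1P-> /set1P->; rewrite eqxx. Qed.

Lemma edge_neq x y : e x y -> x != y.
Proof. by apply: contraTneq => ->; rewrite edge_irr. Qed.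

Lemma clique2 x y : e x y -> is_clique [set x; y].
Proof.
move=> exy; apply/cliqueP => u v /set2P[]-> /set2P[]->; rewrite ?eqxx //.
by rewrite edge_sym.
Qed.

Lemma cliqueU1 x K : is_clique K -> {in K, forall y, e x y} ->
  is_clique (x |: K).
Proof.
move=> /cliqueP cK xK; apply/cliqueP => u v /setU1P[->|uK] /setU1P[->|vK].
- by rewrite eqxx.
- by move=> _; apply: xK.
- by move=> _; rewrite edge_sym; apply: xK.
- exact: cK.
Qed.

Lemma stableU1 x A : is_stable A -> {in A, forall y, ~~ e x y} ->
  is_stable (x |: A).
Proof.
move=> /stableP sA xA; apply/stableP => u v /setU1P[->|uA] /setU1P[->|vA].
- by rewrite edge_irr.
- exact: xA.
- by rewrite edge_sym; apply: xA.
- exact: sA.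
Qed.

Lemma cliqueUU K B : is_clique K -> is_clique B ->
  {in K & B, forall x y, e x y} -> is_clique (K :|: B).
Proof.
move=> /cliqueP cK /cliqueP cB KB; apply/cliqueP => u v.
move=> /setUP[uK|uB] /setUP[vK|vB] nuv; [exact: cK|exact: KB| |exact: cB].
by rewrite edge_sym; apply: KB.
Qed.

Lemma coveredS k A B : B \subset A -> covered k A -> covered k B.
Proof.
elim: k A B => [|k IH] A B sBA /=.
  by move=> /eqP A0; rewrite -subset0 -A0.
case/existsP=> K /andP[cK cA]; apply/existsP; exists K; rewrite cK /=.
by apply: IH cA; apply: setSD.
Qed.

Lemma covered_leq k l A : k <= l -> covered k A -> covered l A.
Proof.
move/subnKC <-; elim: (l - k) => [|d IH]; first by rewrite addn0.
move=> /IH cA; rewrite addnS /=; apply/existsP; exists set0.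
by rewrite setD0 cA andbT; apply/cliqueP => x y; rewrite inE.
Qed.

Lemma coveredU k l A B : covered k A -> covered l B -> covered (k + l) (A :|: B).
Proof.
elim: k A B => [|k IH] A B /=; first by move=> /eqP-> cB; rewrite set0U.
case/existsP=> K /andP[cK cA] cB; apply/existsP; exists K; rewrite cK /=.
rewrite setDUl; apply: IH => //; apply: coveredS cB; exact: subsetDl.
Qed.

Lemma covered_card A : covered #|A| A.
Proof.
move En: #|A| => n; elim: n A En => [|n IH] A An /=; first by rewrite -cards_eq0 An.
have /set0Pn[x xA] : A != set0 by rewrite -cards_eq0 An.
apply/existsP; exists [set x]; rewrite clique1 IH //.
by have := cardsD1 x A; rewrite xA An /= add1n => -[].
Qed.

Lemma covered_ex A : exists k, covered k A.
Proof. by exists #|A|; apply: covered_card. Qed.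

(** [covered k] peels off k cliques one by one, so covers are built and dismantled by induction on
    k, and overlapping or empty cliques do no harm. [theta_setT] identifies the minimum on the whole
    vertex set with [theta]. *)
Definition theta_in A := ex_minn (covered_ex A).
Notation th := theta_in.

Definition alpha_in A := \max_(B : {set G} | is_stable B && (B \subset A)) #|B|.
Notation al := alpha_in.

Lemma theta_le A k : (th A <= k) = covered k A.
Proof.
rewrite /th; case: ex_minnP => m cm min_m; apply/idP/idP => [lmk | /min_m //].
exact: covered_leq cm.
Qed.

Lemma thetaS A B : A \subset B -> th A <= th B.
Proof. by move=> sAB; rewrite theta_le (coveredS sAB) // -theta_le. Qed.

Lemma thetaU A B : th (A :|: B) <= th A + th B.
Proof. by rewrite theta_le coveredU // -theta_le. Qed.

Lemma theta_card A : th A <= #|A|.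
Proof. by rewrite theta_le covered_card. Qed.

Lemma theta0 : th set0 = 0.
Proof. by apply/eqP; rewrite -leqn0 theta_le /=. Qed.

Lemma theta_clique K : is_clique K -> th K <= 1.
Proof.
by move=> cK; rewrite theta_le /=; apply/existsP; exists K; rewrite cK setDv /=.
Qed.

Lemma theta_subU A B C : A \subset B :|: C -> th A <= th B + th C.
Proof. by move=> /thetaS/leq_trans-> //; apply: thetaU. Qed.

Lemma theta_D_clique A K : is_clique K -> th A <= (th (A :\: K)).+1.
Proof.
move=> cK; rewrite -addn1; apply: (@leq_trans (th (A :\: K) + th K)).
  apply: theta_subU; apply/subsetP => x xA.
  by rewrite !inE xA andbT orNb.
by rewrite leq_add2l theta_clique.
Qed.

Lemma theta_D1 A x : th A <= (th (A :\ x)).+1.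
Proof. exact: theta_D_clique (clique1 x). Qed.

Lemma alpha_ge A S : is_stable S -> S \subset A -> #|S| <= al A.
Proof.
move=> sS SA; rewrite /al.
by apply: (@leq_bigmax_cond _ _ (fun B : {set G} => #|B|) S); rewrite sS.
Qed.

Lemma alpha_ex A : exists S, [/\ is_stable S, S \subset A & #|S| = al A].
Proof.
have P0 : is_stable (set0 : {set G}) && (set0 \subset A).
  by rewrite sub0set andbT; apply/stableP => x y; rewrite inE.
have : 0 < #|[pred B : {set G} | is_stable B && (B \subset A)]|.
  by apply/card_gt0P; exists set0.
by case/(eq_bigmax_cond (fun B => #|B|)) => S /andP[sS SA] alS; exists S.
Qed.

Lemma alphaS A B : A \subset B -> al A <= al B.
Proof.
move=> sAB; have [S [sS SA <-]] := alpha_ex A.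
by apply: alpha_ge sS _; apply: subset_trans sAB.
Qed.

Lemma alpha_D A K : al (A :\: K) <= al A.
Proof. exact/alphaS/subsetDl. Qed.

Lemma alpha_anticomplete U A : {in U & A, forall x y, ~~ e x y} ->
  [disjoint U & A] -> al U + al A <= al (U :|: A).
Proof.
move=> UA dUA; have [S [/stableP sS SU <-]] := alpha_ex U.
have [S' [/stableP sS' SA <-]] := alpha_ex A.
rewrite -cardsUI [S :&: S']disjoint_setI0 ?cards0 ?addn0; last first.
  by apply: disjointWl SU _; apply: disjointWr SA dUA.
apply: alpha_ge; last exact: setUSS.
apply/stableP => x y /setUP[xS|xS] /setUP[yS|yS].
- exact: sS.
- by apply: UA; [apply: (subsetP SU)|apply: (subsetP SA)].
- by rewrite edge_sym; apply: UA; [apply: (subsetP SU)|apply: (subsetP SA)].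
- exact: sS'.
Qed.

Lemma alpha_seq A (s : seq G) : {subset s <= A} ->
  pairwise (fun x y => (x != y) && ~~ e x y) s -> size s <= al A.
Proof.
move=> sA; rewrite pairwise_relI => /andP[us ps].
have -> : size s = #|[set x in s]|.
  by rewrite cardsE; symmetry; apply/card_uniqP; rewrite uniq_pairwise.
apply: alpha_ge; last by apply/subsetP => x; rewrite inE; apply: sA.
elim: s ps {us sA} => [_|x s IH /= /andP[xs /IH ss]].
  by apply/stableP => x y; rewrite inE.
rewrite set_cons; apply: stableU1 ss _ => y; rewrite inE => ys.
exact: (allP xs).
Qed.

Lemma clique_seq (s : seq G) : pairwise e s -> is_clique [set x in s].
Proof.
elim: s => [_|x s IH /= /andP[xs /IH ss]].
  by apply/cliqueP => x y; rewrite inE.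
rewrite set_cons; apply: cliqueU1 ss _ => y; rewrite inE => ys.
exact: (allP xs).
Qed.

Lemma theta_seqs A (ss : seq (seq G)) : {subset A <= flatten ss} ->
  all (pairwise e) ss -> th A <= size ss.
Proof.
elim: ss A => [|s ss IH] A sA.
  move=> _; suff -> : A = set0 by rewrite theta0.
  by apply/setP => x; rewrite inE; apply/negP => /sA.
case/andP=> /clique_seq cs ass; apply: leq_trans (theta_D_clique A cs) _.
apply: IH ass => x; rewrite !inE => /andP[xs /sA].
by rewrite /= mem_cat (negPf xs).
Qed.

Definition clique_free n A :=
  [forall K : {set G}, is_clique K ==> (K \subset A) ==> (#|K| < n)].

Lemma clique_freeP n A : reflect
  (forall K, is_clique K -> K \subset A -> #|K| < n) (clique_free n A).
Proof.
apply: (iffP forallP) => H K; last by apply/implyP => cK; apply/implyP; apply: H.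
by move=> cK KA; have := H K; rewrite cK KA.
Qed.

Lemma clique_freeS n A B : B \subset A -> clique_free n A -> clique_free n B.
Proof.
move=> BA /clique_freeP H; apply/clique_freeP => K cK KB; apply: H => //.
exact: subset_trans BA.
Qed.

Lemma subset_of_card n A : n <= #|A| -> exists2 B : {set G}, B \subset A & #|B| = n.
Proof.
move=> nA; exists [set x in take n (enum A)].
  by apply/subsetP => x; rewrite inE => /mem_take; rewrite mem_enum.
have ut : uniq (take n (enum A)) by rewrite take_uniq ?enum_uniq.
by rewrite cardsE (card_uniqP ut) size_takel // -cardE.
Qed.

Lemma clique_free_dec n A : clique_free n A \/
  exists K, [/\ is_clique K, K \subset A & #|K| = n].
Proof.
case: (boolP (clique_free n A)) => [|/forallPn[K]]; first by left.
rewrite !negb_imply -leqNgt => /and3P[cK KA nK]; right.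
have [B BK cB] := subset_of_card nK; exists B; split=> //; first exact: cliqueS cK.
exact: subset_trans KA.
Qed.

Lemma clique_free_seq n A (s : seq G) : clique_free n A -> {subset s <= A} ->
  pairwise e s -> size s < n.
Proof.
move=> /clique_freeP cf sA ps.
have us : uniq s.
  by rewrite uniq_pairwise; apply: sub_pairwise ps => x y; apply: edge_neq.
have <- : #|[set x in s]| = size s by rewrite cardsE (card_uniqP us).
apply: cf; first exact: clique_seq.
by apply/subsetP => x; rewrite inE; apply: sA.
Qed.

Lemma no_triangle A x y z : clique_free 3 A -> x \in A -> y \in A -> z \in A ->
  e x y -> e x z -> ~~ e y z.
Proof.
move=> cf xA yA zA exy exz; apply/negP => eyz.
have := clique_free_seq (s := [:: x; y; z]) cf.
rewrite /= exy exz eyz /= ltnn => H; suff : false by []; apply: H => //.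
by move=> u; rewrite !inE => /or3P[]/eqP->.
Qed.

End Subsets.

Notation th := (@theta_in _).
Notation al := (@alpha_in _).

(** * Matchings in triangle-free graphs *)

Section Gallai.

Variable G : sgraph.
Implicit Types (A B K S U : {set G}) (x y z : G) (f g : {ffun G -> G}).

Notation e := (@edge G).

(* A matching is encoded as an involution; its fixed points are the missed vertices. *)
Definition matching A f := [forall x in A,
  [&& f x \in A, f (f x) == x & (f x != x) ==> e x (f x)]].

Definition missed A f := [set x in A | f x == x].

Lemma matchingP A f : reflect
  {in A, forall x, [/\ f x \in A, f (f x) = x & f x != x -> e x (f x)]}
  (matching A f).
Proof.
apply: (iffP forall_inP) => H x xA; have := H x xA.
  by case/and3P=> fA /eqP ff /implyP.
by case=> fA ff fe; rewrite fA ff eqxx; apply/implyP.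
Qed.

Lemma matchingD A f x : matching A f -> x \in A ->
  matching (A :\: [set x; f x]) f.
Proof.
move=> /matchingP mf xA; have [fxA ffx _] := mf _ xA.
apply/matchingP => y; rewrite !inE negb_or => /andP[/andP[yx yfx] yA].
have [fyA ffy fye] := mf _ yA; split=> //; rewrite fyA andbT negb_or.
apply/andP; split; apply/eqP => fy.
  by case/eqP: yfx; rewrite -fy ffy.
by case/eqP: yx; rewrite -ffy fy ffx.
Qed.

(** Matched pairs and missed vertices are cliques covering A, and twice their number is |A| plus the
    number missed. The induction removes the clique {x, f x}, a singleton at a missed vertex. *)
Lemma theta_matching A f : matching A f -> 2 * th A <= #|A| + #|missed A f|.
Proof.
move En: #|A| => n; elim/ltn_ind: n A En => n IH A An mf.
have [->|/set0Pn[x xA]] := eqVneq A set0; first by rewrite theta0 muln0.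
have [fxA ffx fxe] := matchingP _ _ mf _ xA.
have mD := matchingD mf xA.
have cx : is_clique [set x; f x].
  by have [->|/fxe] := eqVneq (f x) x; [rewrite setUid clique1|apply: clique2].
have tD := theta_D_clique A cx.
have cD : #|A :\: [set x; f x]| + (x != f x).+1 = #|A|.
  rewrite cardsDS ?cards2 ?subnK //; last first.
    by apply/subsetP => y /set2P[]->.
  by rewrite -cards2 subset_leq_card //; apply/subsetP => y /set2P[]->.
have := IH _ _ _ erefl mD; move/(_ ltac:(lia)) => H.
suff : #|missed (A :\: [set x; f x]) f| + (x == f x) <= #|missed A f| by lia.
have sM : missed (A :\: [set x; f x]) f \subset missed A f.
  by apply/subsetP => y; rewrite !inE => /andP[/andP[_ ->] ->].
have [xf|nxf] := eqVneq x (f x); last by rewrite addn0 subset_leq_card.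
rewrite addn1 (cardsD1 x (missed A f)) inE xA -xf eqxx ltnS /=.
apply: subset_leq_card; apply/subsetP => y yM; rewrite !inE in yM *.
by case/andP: yM => /andP[]; rewrite negb_or => /andP[-> _] -> ->.
Qed.

(** Without triangles a clique has at most two vertices, so an optimal cover, freed of overlaps, is
    a matching. Together with [theta_matching], 2 theta(A) is the minimum of |A| plus the number of
    missed vertices. *)
Lemma matching_theta A : clique_free 3 A ->
  exists2 f, matching A f & #|A| + #|missed A f| <= 2 * th A.
Proof.
have : covered (th A) A by rewrite -theta_le.
move: (th A) => k; elim: k A => [|k IH] A.
  move=> /eqP-> _; exists [ffun x => x]; first by apply/matchingP => x; rewrite inE.
  rewrite cards0 (_ : missed _ _ = set0) ?cards0 //.
  by apply/setP => x; rewrite !inE.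
move=> /existsP[K0 /andP[cK0 cA]] cf.
have cA' : covered k (A :\: (K0 :&: A)).
  by rewrite setDIr setDv setU0.
have [f mf lf] := IH _ cA' (clique_freeS (subsetDl _ _) cf).
have cK : is_clique (K0 :&: A) by apply: cliqueS cK0; apply: subsetIl.
have KA : K0 :&: A \subset A by apply: subsetIr.
have := clique_freeP _ _ cf _ cK KA.
move: (K0 :&: A) cK KA mf lf => K cK KA mf lf {cA cA' cK0}.
have [K_0 _|/set0Pn[a aK] K3] := eqVneq K set0.
  by exists f; move: mf lf; rewrite K_0 setD0 // => _; lia.
(* Allowing a = b treats a singleton clique, which becomes a missed vertex, together with an
   edge. *)
have [b Kab] : exists b, K = [set a; b].
  have [Ka|] := eqVneq (K :\ a) set0.
    exists a; rewrite setUid; apply/setP => y; rewrite inE.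
    have /setP/(_ y) := Ka; rewrite !inE; by case: eqVneq => [-> _|_ /=].
  case/set0Pn=> b; rewrite !inE => /andP[ba bK]; exists b.
  apply/eqP; rewrite eq_sym eqEcard cards2 eq_sym ba -ltnS K3 andbT.
  by apply/subsetP => y /set2P[]->.
have bK : b \in K by rewrite Kab set22.
have aA := subsetP KA _ aK; have bA := subsetP KA _ bK.
pose g := [ffun x => if x == a then b else if x == b then a else f x].
have ga : g a = b by rewrite ffunE eqxx.
have gb : g b = a by rewrite ffunE eqxx; case: eqP.
have gN y : y \notin K -> g y = f y.
  by rewrite Kab !inE negb_or ffunE => /andP[/negPf-> /negPf->].
have gM y : y \in A -> y \notin K -> y \in A :\: K by rewrite inE => -> ->.
exists g.
  apply/matchingP => y yA; have [yK|yK] := boolP (y \in K).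
    move: yK; rewrite Kab => /set2P[]->; rewrite ?ga ?gb; split=> // n.
      by apply: (cliqueP _ cK) => //; rewrite eq_sym.
    by apply: (cliqueP _ cK) => //; rewrite eq_sym.
  have [fA ff fe] := matchingP _ _ mf _ (gM y yA yK).
  rewrite gN //; split=> //; first by move: fA; rewrite inE => /andP[].
  by rewrite gN //; move: fA; rewrite inE => /andP[].
have cA : #|A :\: K| + #|K| = #|A|.
  by rewrite cardsDS ?subnK // subset_leq_card.
have cKab : #|K| = (a != b).+1 by rewrite Kab cards2.
suff : #|missed A g| <= #|missed (A :\: K) f| + (a == b) by lia.
have [E|ab] := eqVneq a b.
  rewrite addn1 (cardsD1 a (missed A g)) inE aA ga E eqxx ltnS.
  apply: subset_leq_card; apply/subsetP => y; rewrite !inE => /and3P[yb yA gy].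
  have yK : y \notin K by rewrite Kab E !inE orbb.
  by rewrite yA yK -(gN _ yK).
rewrite addn0; apply: subset_leq_card; apply/subsetP => y.
rewrite !inE => /andP[yA gy]; rewrite yA andbT.
have yK : y \notin K.
  apply: contraL gy; rewrite Kab => /set2P[]->; rewrite ?ga ?gb //.
  by rewrite eq_sym.
by rewrite yK -(gN _ yK).
Qed.

Definition anticomplete U A := {in U & A, forall x y, ~~ e x y}.

(* Optimal matchings of a triangle-free graph correspond to optimal clique
   covers.  The relation [no optimal matching misses both x and y] contains
   adjacency and, when every vertex is missed by some optimal matching, it is
   an equivalence; the proof of transitivity is that of Gallai's lemma. *)
Lemma gallai A : clique_free 3 A -> A != set0 ->
    {in A, forall x, th (A :\ x) < th A} ->
  2 * th A = #|A|.+1 \/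
  exists U, [/\ U \subset A, U != set0, A :\: U != set0 & anticomplete U (A :\: U)].
Proof.
move=> cf /set0Pn[x0 x0A] crit.
pose opt f := matching A f && (#|A| + #|missed A f| <= 2 * th A).
have opt_card f : opt f -> #|A| + #|missed A f| = 2 * th A.
  by case/andP=> mf lf; apply/eqP; rewrite eqn_leq lf theta_matching.
have optM f : opt f -> matching A f by case/andP.
(* A matching from an optimal cover of A minus x, with x left missed, is still optimal on A because
   x is critical. *)
have ex_opt x : x \in A -> exists2 f, opt f & f x = x.
  move=> xA; have := crit x xA.
  have [f mf lf] := matching_theta (clique_freeS (subsetDl A [set x]) cf) => lt.
  pose g := [ffun y => if y == x then x else f y].
  have gx : g x = x by rewrite ffunE eqxx.
  have gN y : y != x -> g y = f y by rewrite ffunE => /negPf->.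
  exists g => //; apply/andP; split.
    apply/matchingP => y yA; have [->|yx] := eqVneq y x.
      by rewrite !gx eqxx; split.
    have [|fA ff fe] := matchingP _ _ mf y; first by rewrite !inE yx yA.
    move: fA; rewrite !inE => /andP[fyx fyA].
    by rewrite gN // gN.
  have : #|missed A g| <= #|missed (A :\ x) f|.+1.
    rewrite (cardsD1 x (missed A g)) inE xA gx eqxx ltnS.
    apply: subset_leq_card; apply/subsetP => y; rewrite !inE => /and3P[yx yA].
    by rewrite gN // yx yA.
  by have := cardsD1 x A; rewrite xA; lia.
have noedge f x y : opt f -> x \in A -> y \in A -> f x = x -> f y = y -> ~~ e x y.
  move=> of_ xA yA fx fy; apply/negP => exy.
  have nxy := edge_neq exy.
  pose g := [ffun z => if z == x then y else if z == y then x else f z].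
  have gx : g x = y by rewrite ffunE eqxx.
  have gy : g y = x by rewrite ffunE eqxx eq_sym (negPf nxy).
  have gN z : z != x -> z != y -> g z = f z.
    by rewrite ffunE => /negPf-> /negPf->.
  have mg : matching A g.
    apply/matchingP => z zA; have [->|zx] := eqVneq z x; first by rewrite gx gy.
    have [->|zy] := eqVneq z y; first by rewrite gy gx edge_sym.
    have [fA ff fe] := matchingP _ _ (optM f of_) z zA.
    rewrite (gN z) // gN //.
      by apply: contraNneq zx => fzx; rewrite -ff fzx fx.
    by apply: contraNneq zy => fzx; rewrite -ff fzx fy.
  have := theta_matching mg; rewrite -(opt_card f of_) leq_add2l leqNgt => /negP; apply.
  apply: proper_card; apply/properP; split.
    apply/subsetP => z; rewrite !inE => /andP[-> gz] /=; move: gz.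
    have [->|zx] := eqVneq z x; first by rewrite gx eq_sym (negPf nxy).
    have [->|zy] := eqVneq z y; first by rewrite gy (negPf nxy).
    by rewrite gN.
  by exists x; rewrite !inE xA ?fx ?gx ?eqxx //= eq_sym.
pose R x y := x = y \/ forall f, opt f -> f x = x -> f y = y -> False.
have Rsym x y : R x y -> R y x.
  by case=> [->|H]; [left|right => f of_ fx fy; apply: (H f)].
have Rtrans x t y : x \in A -> t \in A -> y \in A -> R x t -> R t y -> R x y.
  move=> xA tA yA [-> //|Rxt] [<-|Rty]; first by right.
  have [->|nxy] := eqVneq x y; first by left.
  right=> m om mx my.
  (* Suppose m misses x and y. Among the optimal matchings missing t, n is chosen to agree with m on
     as many vertices as possible; it misses neither x nor y. *)
  have [n0 on0 n0t] := ex_opt t tA.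
  pose P (n : {ffun G -> G}) := opt n && (n t == t).
  have P0 : P n0 by rewrite /P on0 n0t eqxx.
  pose agree (n : {ffun G -> G}) := #|[set z in A | m z == n z]|.
  have [n /andP[on /eqP nt] max_n] := @arg_maxnP _ n0 P agree P0.
  have nx : n x != x by apply/eqP => nx; apply: (Rxt n).
  have ny : n y != y by apply/eqP => ny; apply: (Rty n).
  (* Both matchings miss equally many vertices, and m misses x and y, which n does not. So n misses
     at least two vertices matched by m, one of them other than t. *)
  have [u uD ut] : exists2 u, u \in missed A n :\: missed A m & u != t.
    have cN : #|missed A n| = #|missed A m|.
      by have := opt_card n on; have := opt_card m om; lia.
    have c2 : 1 < #|missed A n :\: missed A m|.
      rewrite cardsD cN setIC -cardsD; apply/card_gt1P; exists x, y.
      by rewrite !inE xA yA mx my nx ny !eqxx.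
    have : 0 < #|(missed A n :\: missed A m) :\ t|.
      by have := cardsD1 t (missed A n :\: missed A m); case: (_ \in _); lia.
    by case/card_gt0P=> u; rewrite in_setD1 => /andP[ut uD]; exists u.
  move: uD; rewrite !inE negb_and; case/andP=> + /andP[uA /eqP nu].
  rewrite uA /= => mu.
  have [mmA mm me] := matchingP _ _ (optM m om) u uA.
  set w := m u in mu mmA mm me.
  have euw : e u w by apply: me.
  have nw : n w != w.
    by apply/eqP => nw; have := noedge n u w on uA mmA nu nw; rewrite euw.
  have [zA nz _] := matchingP _ _ (optM n on) w mmA.
  set z := n w in nw zA nz.
  have zu : z != u.
    by apply: contraNneq mu => zu; rewrite -nz zu nu.
  have wt : w != t by apply: contraNneq nw => wt; rewrite /z wt nt.
  have zt : z != t.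
    by apply: contraNneq wt => zt; rewrite -nz zt nt.
  (* With w the m-partner of u and z the n-partner of w, n is switched to use the edge uw and to
     miss z instead of u. It still misses t and now also agrees with m at u, against the choice of
     n. *)
  pose g := [ffun v => if v == u then w else if v == w then u
                       else if v == z then z else n v].
  have gu : g u = w by rewrite ffunE eqxx.
  have gw : g w = u by rewrite ffunE (negPf mu) eqxx.
  have gz : g z = z by rewrite ffunE (negPf zu) (negPf nw) eqxx.
  have gN v : v != u -> v != w -> v != z -> g v = n v.
    by rewrite ffunE => /negPf-> /negPf-> /negPf->.
  have mg : matching A g.
    apply/matchingP => v vA.
    have [->|vu] := eqVneq v u; first by rewrite gu gw.
    have [->|vw] := eqVneq v w; first by rewrite gw gu edge_sym.
    have [->|vz] := eqVneq v z; first by rewrite !gz eqxx.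
    have [nA nn ne] := matchingP _ _ (optM n on) v vA.
    rewrite (gN v) // gN //.
    - by apply: contraNneq vu => nvu; rewrite -nn nvu nu.
    - by apply: contraNneq vz => nvw; rewrite -nn nvw.
    - by apply: contraNneq vw => nvz; rewrite -nn nvz nz.
  have Pg : P g.
    rewrite /P gN // 1?eq_sym // nt eqxx andbT; apply/andP; split=> //.
    rewrite -(opt_card n on) leq_add2l.
    have zM : z \in missed A g by rewrite inE zA gz eqxx.
    have uM : u \in missed A n by rewrite inE uA nu eqxx.
    rewrite (cardsD1 z (missed A g)) zM (cardsD1 u (missed A n)) uM leq_add2l.
    apply: subset_leq_card; apply/subsetP => v; rewrite !inE => /and3P[vz vA].
    have [->|vu] := eqVneq v u; first by rewrite gu (negPf mu).
    have [->|vw] := eqVneq v w; first by rewrite gw eq_sym (negPf mu).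
    by rewrite gN // vA.
  suff lt_ag : agree n < agree g by have := leq_trans lt_ag (max_n g Pg); rewrite ltnn.
  apply: proper_card; apply/properP; split.
    apply/subsetP => v; rewrite !inE => /andP[vA /eqP mv]; rewrite vA.
    have [vu|vu] := eqVneq v u; first by rewrite vu gu eqxx.
    have [vw|vw] := eqVneq v w; first by rewrite vw gw mm eqxx.
    have [vz|vz] := eqVneq v z; last by rewrite gN // mv eqxx.
    have [_ mmv _] := matchingP _ _ (optM m om) v vA.
    by case/eqP: vu; rewrite -mmv mv vz nz mm.
  by exists u; rewrite !inE uA ?gu ?eqxx //= nu eq_sym; apply/negP => /eqP E; case/eqP: mu.
pose miss2 x y := [exists f : {ffun G -> G}, [&& opt f, f x == x & f y == y]].
have RP x y : R x y <-> (x == y) || ~~ miss2 x y.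
  split.
    case=> [->|H]; first by rewrite eqxx.
    apply/orP; right; apply/existsPn => f; apply/negP.
    by case/and3P=> of_ /eqP fx /eqP fy; apply: (H f).
  case/orP=> [/eqP|/existsPn H]; first by left.
  by right=> f of_ fx fy; have := H f; rewrite of_ fx fy !eqxx.
(* If all vertices are related, an optimal matching misses [x0] only; otherwise the class of x is a
   proper part that no edge leaves. *)
case: (boolP [forall x in A, forall y in A, (x == y) || ~~ miss2 x y]).
  move=> allR; left; have [f of_ fx0] := ex_opt x0 x0A.
  rewrite -(opt_card f of_) -addn1; congr (_ + _); apply/eqP.
  have -> : missed A f = [set x0]; last by rewrite cards1.
  apply/setP => y; rewrite !inE; apply/andP/eqP => [[yA /eqP fy]|->].
    have /forall_inP/(_ _ yA) := forall_inP allR _ x0A.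
    move/RP; case=> [-> //|H]; case: (H f of_ fx0 fy).
  by rewrite x0A fx0 eqxx.
case/forall_inPn=> x xA /forall_inPn[y yA nR]; right.
exists [set z in A | (x == z) || ~~ miss2 x z]; split.
- by apply/subsetP => z; rewrite inE => /andP[].
- by apply/set0Pn; exists x; rewrite inE xA eqxx.
- by apply/set0Pn; exists y; rewrite !inE yA /= andbT.
- move=> u v; rewrite !inE => /andP[uA Rxu] /andP[+ vA]; rewrite vA /=.
  apply: contra => euv; apply/RP; apply: (Rtrans x u v) => //; first exact/RP.
  by right=> f of_ fu fv; have := noedge f u v of_ uA vA fu fv; rewrite euv.
Qed.

End Gallai.

(** * Ramsey bounds *)

Definition nbr (G : sgraph) (A : {set G}) x := [set y in A | edge x y].

(** The bound R(3, a) <= n, relativised to the subsets of one graph so that it can also be used in a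
    complement. *)
Definition ramsey (G : sgraph) a n :=
  forall A : {set G}, clique_free 3 A -> n <= #|A| -> a <= al A.

Section Ramsey.

Variable G : sgraph.
Implicit Types (A B K S U : {set G}) (x y z : G).

Notation e := (@edge G).

Lemma nbr_sub A x : nbr A x \subset A.
Proof. by apply/subsetP => y; rewrite inE => /andP[]. Qed.

Lemma nbr_alpha A x : clique_free 3 A -> x \in A -> #|nbr A x| <= al A.
Proof.
move=> cf xA; apply: alpha_ge (nbr_sub A x); apply/stableP => y z.
rewrite !inE => /andP[yA xy] /andP[zA xz]; exact: (no_triangle cf xA).
Qed.

Lemma alpha_nonnbr A x : x \in A -> (al (A :\: (x |: nbr A x))).+1 <= al A.
Proof.
move=> xA; have [S [sS SA <-]] := alpha_ex (A :\: (x |: nbr A x)).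
have xS : x \notin S by apply/negP => /(subsetP SA); rewrite !inE eqxx.
rewrite -add1n -[1]/(true : nat) -xS -cardsU1; apply: alpha_ge.
  apply: stableU1 => // y /(subsetP SA); rewrite !inE negb_or.
  by case/andP=> /andP[_ nxy] yA; rewrite yA in nxy.
apply/subsetP => y /setU1P[-> //|/(subsetP SA)]; by rewrite inE => /andP[].
Qed.

Lemma ramsey_nbr a n A x : ramsey G a n -> clique_free 3 A -> x \in A ->
  n + #|nbr A x| < #|A| -> a < al A.
Proof.
move=> r cf xA lt; apply: leq_trans (alpha_nonnbr xA).
rewrite ltnS; apply: r; first exact: clique_freeS (subsetDl _ _) cf.
have sA : x |: nbr A x \subset A by rewrite subUset sub1set xA nbr_sub.
have xN : x \notin nbr A x by rewrite inE edge_irr andbF.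
by rewrite cardsDS // cardsU1 xN; lia.
Qed.

(** A neighbourhood is stable, so a + 1 neighbours suffice; with at most a neighbours, at least n
    vertices are not adjacent to x, and a stable set among them extends by x. *)
Lemma ramsey_step a n : ramsey G a n -> ramsey G a.+1 (n + a.+1).
Proof.
move=> r A cf nA; have /card_gt0P[x xA] : 0 < #|A| by lia.
have [|lt] := leqP a.+1 #|nbr A x|.
  by move/leq_trans; apply; apply: nbr_alpha.
by apply: (ramsey_nbr r cf xA); lia.
Qed.

Lemma ramsey11 : ramsey G 1 1.
Proof.
move=> A _ /card_gt0P[x xA].
by apply: (@alpha_seq _ A [:: x]) => [y|//]; rewrite inE => /eqP->.
Qed.

(** R(3, 3) <= 6, by two rounds of the recursion from R(3, 1) <= 1. The digits of the name are a and
    n, unlike those of [ramsey36_adj]. *)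
Lemma ramsey36 : ramsey G 3 6.
Proof. exact (ramsey_step (n := 3) (ramsey_step (n := 1) ramsey11)). Qed.

(** The handshake lemma, by deleting x: its degree counts once at x and once spread over its
    neighbours. *)
Lemma odd_sum_deg A : ~~ odd (\sum_(x in A) #|nbr A x|).
Proof.
move En: #|A| => n; elim: n A En => [|n IH] A An.
  by have /eqP := An; rewrite cards_eq0 => /eqP->; rewrite big_set0.
have /card_gt0P[x xA] : 0 < #|A| by rewrite An.
have An1 : #|A :\ x| = n by have := cardsD1 x A; rewrite xA An; lia.
have E : nbr (A :\ x) x = nbr A x.
  apply/setP => y; rewrite !inE; case: eqVneq => [->|//].
  by rewrite edge_irr !andbF.
have -> : \sum_(y in A) #|nbr A y| =
    #|nbr A x| + (\sum_(y in A :\ x) #|nbr (A :\ x) y| + #|nbr A x|).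
  rewrite (big_setD1 x xA) /=; congr (_ + _).
  rewrite -E -(sum1_card (mem (nbr (A :\ x) x))).
  have -> : \sum_(i in nbr (A :\ x) x) 1 = \sum_(y in A :\ x) (e x y : nat).
    rewrite [RHS]big_mkcond /= big_mkcond /=; apply: eq_bigr => y _.
    by rewrite !inE; case: (y != x); case: (y \in A); case: (e x y).
  rewrite -big_split /=; apply: eq_bigr => y yA.
  rewrite (cardsD1 x (nbr A y)) inE xA edge_sym addnC /=; congr (_ + _).
  by apply: eq_card => z; rewrite !inE; case: (z == x).
by rewrite addnCA addnn oddD odd_double addbF; apply: IH.
Qed.

(* On 9 vertices the recursion would need a cubic graph of odd order. *)
Lemma ramsey49 : ramsey G 4 9.
Proof.
move=> A0 cf0 nA0; have [A AA0 An] := subset_of_card nA0.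
have cf := clique_freeS AA0 cf0.
apply: leq_trans (alphaS AA0); rewrite leqNgt; apply/negP => al3.
have deg x : x \in A -> #|nbr A x| = 3.
  move=> xA; apply/eqP; rewrite eqn_leq; apply/andP; split.
    by apply: leq_trans (nbr_alpha cf xA) _; rewrite -ltnS.
  rewrite leqNgt; apply/negP => lt.
  by have := ramsey_nbr ramsey36 cf xA; rewrite An; lia.
have := odd_sum_deg A; rewrite (eq_bigr (fun=> 3)) => [|x xA]; last exact: deg.
by rewrite sum_nat_const An.
Qed.

Lemma ramsey5_14 : ramsey G 5 14.
Proof. exact (ramsey_step (n := 9) ramsey49). Qed.

End Ramsey.

(** * Ramsey bounds read in the complement *)

Section Complement.

Variable G : sgraph.

Definition co_edge : rel G := fun x y => (x != y) && ~~ edge x y.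

Lemma co_edge_sym : symmetric co_edge.
Proof. by move=> x y; rewrite /co_edge eq_sym edge_sym. Qed.

Lemma co_edge_irr : irreflexive co_edge.
Proof. by move=> x; rewrite /co_edge eqxx. Qed.

Definition complement := SGraph co_edge_sym co_edge_irr.

Lemma stable_complement (S : {set G}) : @is_stable complement S -> is_clique S.
Proof.
move=> /(@stableP complement) sS; apply/cliqueP => x y xS yS nxy.
by have := sS x y xS yS; rewrite /= /co_edge nxy negbK.
Qed.

Lemma clique_complement (S : {set G}) : @is_clique complement S -> is_stable S.
Proof.
move=> /(@cliqueP complement) cS; apply/stableP => x y xS yS.
have [->|nxy] := eqVneq x y; first by rewrite edge_irr.
by have := cS x y xS yS nxy; rewrite /= /co_edge nxy.
Qed.

(** Stability number at most two makes the complement triangle-free, and its stable sets are cliques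
    of [G]. *)
Lemma ramsey_clique a n (A : {set G}) : ramsey complement a n -> al A <= 2 ->
  n <= #|A| -> exists K, [/\ is_clique K, K \subset A & #|K| = a].
Proof.
move=> r alA nA; have /(r _)/(_ nA) aA : @clique_free complement 3 A.
  apply/(@clique_freeP complement) => K /clique_complement sK KA.
  by rewrite ltnS; apply: leq_trans alA; apply: alpha_ge.
have [S [/stable_complement cS SA cS_]] := @alpha_ex complement A.
rewrite -cS_ in aA; have [B BS cB] := subset_of_card aA.
by exists B; split=> //; [apply: cliqueS cS | apply: subset_trans SA].
Qed.

End Complement.

(** * Five-holes *)

Section FiveHoles.

Variable G : sgraph.
Implicit Types (A B K S U C P : {set G}) (x y z k : G).

Notation e := (@edge G).

Definition hole5 c0 c1 c2 c3 c4 :=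
  [&& e c0 c1, e c1 c2, e c2 c3, e c3 c4 & e c4 c0] &&
  [&& ~~ e c0 c2, ~~ e c1 c3, ~~ e c2 c4, ~~ e c3 c0 & ~~ e c4 c1].

Definition is_hole5 C := exists c0 c1 c2 c3 c4,
  hole5 c0 c1 c2 c3 c4 /\ C = [set x in [:: c0; c1; c2; c3; c4]].

(** Vertices at distance two on the cycle are told apart by a third vertex adjacent to exactly one
    of them. *)
Lemma hole5_uniq c0 c1 c2 c3 c4 : hole5 c0 c1 c2 c3 c4 ->
  uniq [:: c0; c1; c2; c3; c4].
Proof.
case/andP=> /and5P[e01 e12 e23 e34 e40] /and5P[n02 n13 n24 n30 n41].
have D x y z : e x z -> ~~ e y z -> x != y.
  by move=> xz; apply: contraNneq => <-.
rewrite /= !inE !negb_or !andbT.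
rewrite (edge_neq e01) (edge_neq e12) (edge_neq e23) (edge_neq e34).
rewrite (eq_sym c0 c4) (edge_neq e40).
have -> : c0 != c2 by apply: (D _ _ c4); rewrite // edge_sym.
have -> : c0 != c3 by apply: (D _ _ c1) => //; rewrite edge_sym.
have -> : c1 != c3 by apply: (D _ _ c0); rewrite // edge_sym.
have -> : c1 != c4 by apply: (D _ _ c2) => //; rewrite edge_sym.
by have -> : c2 != c4 by apply: (D _ _ c1); rewrite // edge_sym.
Qed.

Lemma hole5_card C : is_hole5 C -> #|C| = 5.
Proof.
move=> [c0 [c1 [c2 [c3 [c4 [/hole5_uniq u ->]]]]]].
by rewrite cardsE (card_uniqP u).
Qed.

Lemma hole5_theta C : is_hole5 C -> th C <= 3.
Proof.
move=> [c0 [c1 [c2 [c3 [c4 [/andP[/and5P[e01 e12 e23 e34 e40] _] ->]]]]]].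
apply: (@theta_seqs _ _ [:: [:: c0; c1]; [:: c2; c3]; [:: c4]]).
  by move=> x; rewrite inE.
by rewrite /= e01 e23.
Qed.

Lemma hole5_alpha C : is_hole5 C -> 2 <= al C.
Proof.
move=> [c0 [c1 [c2 [c3 [c4 [h ->]]]]]].
apply: (@alpha_seq _ _ [:: c0; c2]) => [x|].
  by rewrite !inE => /orP[]/eqP->; rewrite eqxx ?orbT.
have := hole5_uniq h; rewrite /= !inE !negb_or.
by case/andP: h => _ /and5P[-> _ _ _ _] /andP[/and4P[_ -> _ _] _].
Qed.

(** x is paired with y, and the remaining path on four vertices splits into two edges. *)
Lemma hole5_absorb C x : is_hole5 C -> (exists2 y, y \in C & e x y) ->
  th (x |: C) <= 3.
Proof.
move=> [c0 [c1 [c2 [c3 [c4 [/andP[/and5P[e01 e12 e23 e34 e40] _] ->]]]]]] [y].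
have aux d0 d1 d2 d3 d4 : e x d0 -> e d1 d2 -> e d3 d4 ->
    [set x in [:: c0; c1; c2; c3; c4]] \subset [:: d0; d1; d2; d3; d4] ->
    th (x |: [set x in [:: c0; c1; c2; c3; c4]]) <= 3.
  move=> xd d12 d34 /subsetP s.
  apply: (@theta_seqs _ _ [:: [:: x; d0]; [:: d1; d2]; [:: d3; d4]]).
    by move=> z /setU1P[->|/s H]; rewrite /= inE ?eqxx // H orbT.
  by rewrite /= xd d12 d34.
rewrite !inE => /or4P[/eqP->|/eqP->|/eqP->|/orP[/eqP->|/eqP->]] xy.
- apply: (aux c0 c1 c2 c3 c4) => //; by apply/subsetP=> z; rewrite inE.
- apply: (aux c1 c2 c3 c4 c0) => //; by apply/subsetP=> z; rewrite inE -(mem_rot 1).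
- apply: (aux c2 c3 c4 c0 c1) => //; by apply/subsetP=> z; rewrite inE -(mem_rot 2).
- apply: (aux c3 c4 c0 c1 c2) => //; by apply/subsetP=> z; rewrite inE -(mem_rot 3).
- apply: (aux c4 c0 c1 c2 c3) => //; by apply/subsetP=> z; rewrite inE -(mem_rot 4).
Qed.

(* In a 5-hole, the neighbours of a dominating vertex contain three consecutive
   vertices. *)
Definition dominates k C :=
  [forall x in C, forall y in C, (x != y) && ~~ e x y ==> e k x || e k y].

Lemma not_dominates k C : ~~ dominates k C -> exists x y,
  [/\ x \in C, y \in C, x != y & [&& ~~ e x y, ~~ e k x & ~~ e k y]].
Proof.
case/forall_inPn=> x xC /forall_inPn[y yC].
rewrite negb_imply negb_or -!andbA => /and4P[nxy ne kx ky].
by exists x, y; split=> //; apply/and3P.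
Qed.

(** Each vertex of K joins a clique Q of the cover to which it is complete. Vertices joining the
    same Q are adjacent to each other, so Q stays a clique, and K is covered at no cost. *)
Lemma clique_absorb (Qs : seq {set G}) K : all (@is_clique G) Qs -> is_clique K ->
  {in K, forall k, exists2 Q, Q \in Qs & {in Q, forall y, e k y}} ->
  th (K :|: \bigcup_(Q <- Qs) Q) <= size Qs.
Proof.
elim: Qs K => [|Q Qs IH] K /=.
  move=> _ _ H; rewrite big_nil setU0 leqn0.
  suff -> : K = set0 by rewrite theta0.
  by apply/setP => k; rewrite inE; apply/negP => /H[].
case/andP=> cQ cQs cK H; rewrite big_cons.
pose K1 := [set k in K | [forall y in Q, e k y]].
have cK1 : is_clique (K1 :|: Q).
  apply: cliqueUU => //.
    by apply: cliqueS cK; apply/subsetP => k; rewrite inE => /andP[].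
  by move=> k y; rewrite inE => /andP[_ /forall_inP]; apply.
have cK2 : is_clique (K :\: K1) by apply: cliqueS cK; apply: subsetDl.
apply: (@leq_trans (th (K1 :|: Q) + th ((K :\: K1) :|: \bigcup_(Q <- Qs) Q))).
  apply: theta_subU; apply/subsetP => k; rewrite !in_setU in_setD.
  by case: (k \in K1); case: (k \in K); case: (k \in Q).
rewrite -add1n leq_add ?theta_clique //; apply: IH => // k.
rewrite !inE => /andP[kK1 kK]; have [Q' + kQ'] := H k kK.
rewrite inE => /orP[/eqP E|Q'Qs]; last by exists Q'.
case/negP: kK1; rewrite kK; apply/forall_inP => y yQ; apply: kQ'.
by rewrite E.
Qed.

(** The non-neighbours of k on the hole are pairwise adjacent. If k misses c0, it sees c2 and c3 and
    one of the non-adjacent c1 and c4, which completes one of the two edges. *)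
Lemma dominates_part k c0 c1 c2 c3 c4 : hole5 c0 c1 c2 c3 c4 ->
  dominates k [set x in [:: c0; c1; c2; c3; c4]] ->
  exists2 Q, Q \in [:: [set c0]; [set c1; c2]; [set c3; c4]]
           & {in Q, forall y, e k y}.
Proof.
move=> h /forall_inP dom.
have := hole5_uniq h; rewrite /= !inE !negb_or.
case/andP: h => _ /and5P[n02 n13 n24 n30 n41].
case/and5P=> /and4P[d01 d02 d03 d04] /and3P[d12 d13 d14] _ _ _.
have D x y : x \in [:: c0; c1; c2; c3; c4] -> y \in [:: c0; c1; c2; c3; c4] ->
    x != y -> ~~ e x y -> ~~ e k x -> e k y.
  move=> xs ys dxy nxy nkx.
  have [xC yC] : x \in [set z in [:: c0; c1; c2; c3; c4]]
              /\ y \in [set z in [:: c0; c1; c2; c3; c4]].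
    by rewrite !in_set; split.
  by have /forall_inP/(_ _ yC) := dom _ xC; rewrite dxy nxy (negPf nkx).
have [k0|k0] := boolP (e k c0).
  by exists [set c0]; rewrite ?inE ?eqxx // => y /set1P->.
have k2 : e k c2 by apply: (D c0); rewrite ?inE ?eqxx ?orbT.
have k3 : e k c3 by apply: (D c0); rewrite ?inE ?eqxx ?orbT // edge_sym.
have [k1|k1] := boolP (e k c1).
  by exists [set c1; c2]; rewrite ?inE ?eqxx ?orbT // => y /set2P[]->.
have k4 : e k c4 by apply: (D c1); rewrite ?inE ?eqxx ?orbT // edge_sym.
by exists [set c3; c4]; rewrite ?inE ?eqxx ?orbT // => y /set2P[]->.
Qed.

(** Three cliques partitioning the hole and the singletons of P form a cover that absorbs K. *)
Lemma cone_theta K C P : is_clique K -> is_hole5 C ->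
  {in K, forall k, dominates k C || [exists p in P, e k p]} ->
  th (K :|: (C :|: P)) <= #|P| + 3.
Proof.
move=> cK [c0 [c1 [c2 [c3 [c4 [h defC]]]]]] H.
pose Qs := [:: [set c0]; [set c1; c2]; [set c3; c4]] ++ [seq [set p] | p <- enum P].
have sQs : size Qs = #|P| + 3 by rewrite size_cat size_map -cardE addnC.
have eQs : C :|: P = \bigcup_(Q <- Qs) Q.
  rewrite big_cat /= !big_cons big_nil setU0; congr (_ :|: _).
    by rewrite defC; apply/setP => x; rewrite !inE !orbA.
  rewrite big_map big_enum /=; apply/setP => x; apply/idP/bigcupP => [xP|[p pP]].
    by exists x; rewrite ?set11.
  by move/set1P->.
rewrite eQs -sQs; apply: clique_absorb => //.
  rewrite all_cat /= !clique1; case/andP: h => /and5P[_ e12 _ e34 _] _.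
  rewrite !clique2 //=; apply/allP => Q /mapP[p _ ->]; exact: clique1.
move=> k kK; have /orP[dom|/exists_inP[p pP kp]] := H k kK.
  have [|Q QQ kQ] := @dominates_part k _ _ _ _ _ h; first by rewrite -defC.
  by exists Q => //; rewrite mem_cat QQ.
exists [set p]; last by move=> y /set1P->.
by rewrite mem_cat map_f ?orbT // mem_enum.
Qed.

Lemma not_dominates_alpha k C P : ~~ dominates k C -> is_stable P ->
  anticomplete P C -> [disjoint P & C] -> {in P, forall p, ~~ e k p} ->
  k \notin C :|: P -> #|P| + 2 < al (k |: (C :|: P)).
Proof.
move=> /not_dominates[x [y [xC yC nxy /and3P[exy kx ky]]]] sP aPC dPC kP.
rewrite !inE negb_or => /andP[kC kP'].
have xP : x \notin P by apply: contraL xC => /(disjointFr dPC)->.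
have yP : y \notin P by apply: contraL yC => /(disjointFr dPC)->.
have -> : #|P| + 2 = #|[set x; y] :|: P|.-1.+1 + 0.
  by rewrite -setUA !cardsU1 !inE negb_or nxy xP yP /=; lia.
rewrite addn0 prednK; last by apply/card_gt0P; exists x; rewrite !inE eqxx.
have kS : k \notin [set x; y] :|: P.
  by rewrite !inE !negb_or kP' andbT; apply/andP; split; apply: contraNneq kC => ->.
rewrite -[X in X <= _]add1n -[1]/(true : nat) -kS -cardsU1; apply: alpha_ge.
  apply: stableU1; last first.
    by move=> z; rewrite !inE => /orP[/orP[]/eqP->|/kP].
  rewrite -setUA; apply: stableU1; first apply: stableU1 => //.
  - by move=> z zP; rewrite edge_sym; apply: aPC.
  - by move=> z /setU1P[->|zP] //; rewrite edge_sym; apply: aPC.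
apply/subsetP => z; rewrite !inE => /orP[->//|/orP[/orP[]/eqP->|->]];
  by rewrite ?xC ?yC ?orbT.
Qed.

(* Each [k] in [K] can join a vertex of [P] or one of three cliques covering [C]:
   otherwise [k], [P] and a stable pair of [C] form a stable set of size #|P| + 3. *)
Lemma cone K C P : is_clique K -> is_hole5 C -> is_stable P ->
  anticomplete P C -> [disjoint P & C] -> [disjoint K & C :|: P] ->
  al (K :|: (C :|: P)) <= #|P| + 2 -> th (K :|: (C :|: P)) <= #|P| + 3.
Proof.
move=> cK hC sP aPC dPC dK alK; apply: cone_theta => // k kK.
rewrite orbC; case: exists_inP => //= nP; apply: contraLR alK => ndom.
rewrite -ltnNge; apply: leq_trans (not_dominates_alpha ndom sP aPC dPC _ _) _.
- by move=> p pP; apply/negP => kp; apply: nP; exists p.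
- by rewrite (disjointFr dK).
- by apply: alphaS; rewrite setSU // sub1set.
Qed.

End FiveHoles.

(** * Minimal graphs of a given gap *)

(** The gap of A exceeds t, so [excess 0] means gap at least one. Its absence on all subsets of at
    most n vertices is [gap_bound G n t]; for all graphs this gives s(t + 1) > n. *)
Definition excess (G : sgraph) t (A : {set G}) := al A + t < th A.

Definition gap_bound (G : sgraph) n t := forall A : {set G}, #|A| <= n -> th A <= al A + t.

Section Excess.

Variable G : sgraph.
Implicit Types (A B K S U : {set G}) (x y z : G) (n t : nat).

Notation e := (@edge G).

Lemma excess_minimal A t : excess t A -> exists2 B : {set G}, B \subset A & minset (excess t) B.
Proof. by case/minset_exists=> B mB BA; exists B. Qed.

Lemma minset_excess A t : minset (excess t) A -> excess t A.
Proof. exact: minsetp. Qed.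

Lemma minset_proper A B t : minset (excess t) A -> B \proper A -> th B <= al B + t.
Proof.
move=> /minsetP[_ H] /andP[BA nAB]; rewrite leqNgt; apply/negP => xB.
by case/negP: nAB; rewrite -(H B xB BA).
Qed.

Lemma gap_boundS n t : gap_bound G n t -> gap_bound G n.+1 t.+1.
Proof.
move=> b A An; have [->|/set0Pn[x xA]] := eqVneq A set0; first by rewrite theta0.
have := theta_D1 A x; have := alpha_D A [set x].
have : #|A :\ x| <= n by have := cardsD1 x A; rewrite xA; lia.
by move/b; lia.
Qed.

Lemma gap_bound_card n t A : gap_bound G n t -> excess t A -> n < #|A|.
Proof. by move=> b; rewrite ltnNge; apply: contraL => /b; rewrite /excess -leqNgt. Qed.

Lemma excess_D A K t : is_clique K -> excess t.+1 A -> excess t (A :\: K).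
Proof.
by move=> cK; have := theta_D_clique A cK; have := alpha_D A K; rewrite /excess; lia.
Qed.

Lemma minimal_critical A t x : minset (excess t) A -> x \in A -> th (A :\ x) < th A.
Proof.
move=> mA xA; have := minset_excess mA; have := minset_proper mA (properD1 xA).
by have := alpha_D A [set x]; rewrite /excess; lia.
Qed.

(** With at most one neighbour, x and its neighbours form a clique whose deletion lowers theta by at
    most one and alpha by at least one, so the excess would survive on a proper subset. *)
Lemma minimal_degree A t x : minset (excess t) A -> x \in A -> 1 < #|nbr A x|.
Proof.
move=> mA xA; rewrite ltnNge; apply/negP => le1.
have cK : is_clique (x |: nbr A x).
  apply: cliqueU1; last by move=> y; rewrite inE => /andP[].
  apply/cliqueP => y z yN zN.
  by have /card_le1_eqP/(_ _ _ yN zN)-> := le1; rewrite eqxx.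
have pA : A :\: (x |: nbr A x) \proper A.
  apply/properP; split; first exact: subsetDl.
  by exists x; rewrite // !inE eqxx.
have := minset_excess mA; have := minset_proper mA pA.
have := alpha_nonnbr xA; have := theta_D_clique A cK; rewrite /excess; lia.
Qed.

(** In the disconnected alternative the two inequalities say that the gap of A is at most the sum of
    the gaps of the parts. *)
Lemma gallai_minimal A t : minset (excess t) A -> clique_free 3 A ->
  2 * th A = #|A|.+1 \/
  exists U V, [/\ U :|: V = A, U \proper A, V \proper A, anticomplete U V &
    [/\ #|U| + #|V| = #|A|, al U + al V <= al A & th A <= th U + th V]].
Proof.
move=> mA cf.
have A0 : A != set0.
  apply: contraTneq (minset_excess mA) => ->; by rewrite /excess theta0.
have [E|[U [UA U0 V0 aU]]] := gallai cf A0 (fun x => minimal_critical mA).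
  by left.
right; exists U, (A :\: U).
have dU : [disjoint U & A :\: U] by rewrite -setI_eq0 setIDA setIC -setIDA setDv setI0.
have defA : U :|: (A :\: U) = A by rewrite -{2}(setID A U) (setIidPr UA).
split=> //.
- rewrite properEcard UA; have := cardsDS UA; move: V0; rewrite -card_gt0.
  by have := subset_leq_card UA; lia.
- rewrite properEcard subsetDl cardsDS //; move: U0; rewrite -card_gt0.
  by have := subset_leq_card UA; lia.
split.
- by rewrite cardsDS // subnKC // subset_leq_card.
- by have := alpha_anticomplete aU dU; rewrite defA.
- by have := thetaU U (A :\: U); rewrite defA.
Qed.

End Excess.

(** * Gap of graphs with at most nine vertices *)

Section AtMostNine.

Variable G : sgraph.
Implicit Types (A B K S U C D P : {set G}) (x y z : G) (n t : nat).

Notation e := (@edge G).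

(** Split graphs have gap zero: either every vertex of K has a neighbour in D and joins its
    singleton, or some k extends D to a stable set and |D| + 1 cliques are affordable. *)
Lemma split_theta K D : is_clique K -> is_stable D -> [disjoint K & D] ->
  th (K :|: D) <= al (K :|: D).
Proof.
move=> cK sD dKD.
have D_al : #|D| <= al (K :|: D) by apply: alpha_ge sD (subsetUr _ _).
case: (boolP [forall k in K, [exists d in D, e k d]]) => [/forall_inP H|].
  apply: leq_trans D_al; pose Qs := [seq [set d] | d <- enum D].
  have -> : #|D| = size Qs by rewrite size_map -cardE.
  have {1}-> : D = \bigcup_(Q <- Qs) Q.
    rewrite big_map big_enum /=; apply/setP => x; apply/idP/bigcupP => [xD|[d dD]].
      by exists x; rewrite ?set11.
    by move/set1P->.
  apply: clique_absorb => // [|k kK].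
    by apply/allP => Q /mapP[d _ ->]; apply: clique1.
  have /exists_inP[d dD kd] := H k kK; exists [set d]; last by move=> y /set1P->.
  by rewrite map_f // mem_enum.
case/forall_inPn=> k kK /exists_inPn kD.
have kD' : k \notin D by rewrite (disjointFr dKD).
apply: (leq_trans (thetaU K D)); apply: (@leq_trans #|k |: D|).
  by rewrite cardsU1 kD' leq_add ?theta_card ?theta_clique.
apply: alpha_ge; first exact: stableU1.
by apply: setSU; rewrite sub1set.
Qed.

Lemma split_no_excess A K t : is_clique K -> K \subset A -> is_stable (A :\: K) ->
  ~~ excess t A.
Proof.
move=> cK KA sD; have dK : [disjoint K & A :\: K].
  by rewrite -setI_eq0 setIDA setIC -setIDA setDv setI0.
have := split_theta cK sD dK; rewrite -{1 3}(setIidPr KA) setID /excess.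
by rewrite -leqNgt => /leq_trans-> //; apply: leq_addr.
Qed.

Lemma alpha_le1_clique A : al A <= 1 -> is_clique A.
Proof.
move=> al1; apply/cliqueP => x y xA yA nxy; apply: contraLR al1 => exy.
rewrite -ltnNge; apply: (@alpha_seq _ _ [:: x; y]) => [z|].
  by rewrite !inE => /orP[]/eqP->.
by rewrite /= nxy exy.
Qed.

Lemma alpha_gt0 A : 0 < #|A| -> 0 < al A.
Proof.
case/card_gt0P=> x xA; apply: (@alpha_seq _ A [:: x]) => [y|//].
by rewrite inE => /eqP->.
Qed.

Lemma excess_alpha_gt1 A t : excess t A -> 1 < al A.
Proof.
move=> xA; rewrite ltnNge; apply/negP => al1.
have := theta_clique (alpha_le1_clique al1).
have := @alpha_gt0 A; have := theta_card A; move: xA; rewrite /excess; lia.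
Qed.

Lemma theta_lt_card A : ~~ is_stable A -> th A < #|A|.
Proof.
case/forall_inPn=> x xA /forall_inPn[y yA]; rewrite negbK => exy.
have := theta_D_clique A (clique2 exy); have := theta_card (A :\: [set x; y]).
have sA : [set x; y] \subset A by apply/subsetP => z /set2P[]->.
have := subset_leq_card sA.
by rewrite cardsDS // cards2 (edge_neq exy); lia.
Qed.

Lemma alpha_triple A x y z : x \in A -> y \in A -> z \in A ->
  [&& x != y, x != z & y != z] -> [&& ~~ e x y, ~~ e x z & ~~ e y z] -> 2 < al A.
Proof.
move=> xA yA zA /and3P[xy xz yz] /and3P[exy exz eyz].
apply: (@alpha_seq _ A [:: x; y; z]) => [u|].
  by rewrite !inE => /or3P[]/eqP->.
by rewrite /= xy xz yz exy exz eyz.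
Qed.

(** For t = 0 both parts of a disconnected minimal set would have gap zero, and then so would the
    set. *)
Lemma gallai_minimal0 A : minset (excess 0) A -> clique_free 3 A ->
  2 * th A = #|A|.+1.
Proof.
move=> mA cf; have [//|[U [V [_ pU pV _ [_]]]]] := gallai_minimal mA cf.
have := minset_excess mA; have := minset_proper mA pU; have := minset_proper mA pV.
rewrite /excess; lia.
Qed.

(** A triangle leaves at most one vertex, hence a split graph. A triangle-free minimal set has theta
    at most (4 + 1) / 2, but needs more than alpha, which is at least 2. *)
Lemma gap_bound4 : gap_bound G 4 0.
Proof.
move=> A A4; rewrite leqNgt; apply/negP => /excess_minimal[B BA mB].
have xB := minset_excess mB.
have {A4 BA A} B4 : #|B| <= 4 by apply: leq_trans (subset_leq_card BA) A4.
have [cf|[K [cK KB cK3]]] := clique_free_dec 3 B.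
  have := gallai_minimal0 mB cf; have := excess_alpha_gt1 xB.
  by move: xB; rewrite /excess; lia.
have : ~~ excess 0 B; last by rewrite xB.
apply: (split_no_excess _ cK KB); apply/stableP => x y xD yD.
have : #|B :\: K| <= 1 by rewrite cardsDS // cK3; lia.
by move/card_le1_eqP=> /(_ _ _ xD yD)->; rewrite edge_irr.
Qed.

Lemma gap_bound5 : gap_bound G 5 1.
Proof. exact: gap_boundS gap_bound4. Qed.

(** A triangle would leave two vertices: non-adjacent they give a split graph, adjacent a cover by
    two cliques. So theta is 3 and alpha 2, and [c0] has degree 2, by minimality and since a
    neighbourhood is stable; its two non-neighbours close the cycle. *)
Lemma excess_card5 A : excess 0 A -> #|A| = 5 -> is_hole5 A.
Proof.
move=> xA A5; have mA : minset (excess 0) A.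
  apply/minsetP; split=> // B xB BA; apply/eqP; rewrite eqEcard BA A5.
  exact: gap_bound_card gap_bound4 xB.
have [cf|[K [cK KA cK3]]] := clique_free_dec 3 A; last first.
  have cD : #|A :\: K| = 2 by rewrite cardsDS // A5 cK3.
  have sD : is_stable (A :\: K).
    apply/negPn/negP => /theta_lt_card; rewrite cD => tD.
    have := theta_D_clique A cK; have := excess_alpha_gt1 xA.
    by move: xA; rewrite /excess; lia.
  by have := split_no_excess 0 cK KA sD; rewrite xA.
have al2 : al A <= 2.
  by have := gallai_minimal0 mA cf; move: xA; rewrite /excess A5; lia.
have /card_gt0P[c0 c0A] : 0 < #|A| by rewrite A5.
have cN : #|nbr A c0| == 2.
  by rewrite eqn_leq (minimal_degree mA) // (leq_trans (nbr_alpha cf c0A)).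
have sN : c0 |: nbr A c0 \subset A by rewrite subUset sub1set c0A nbr_sub.
have cM : #|A :\: (c0 |: nbr A c0)| == 2.
  by rewrite cardsDS // cardsU1 inE edge_irr andbF A5 (eqP cN).
have [c1 [c4 [d14 defN]]] := cards2P _ cN.
have [c2 [c3 [d23 defM]]] := cards2P _ cM.
have mN c : c \in nbr A c0 -> c \in A /\ e c0 c by rewrite inE => /andP.
have [c1A e01] := mN c1 ltac:(by rewrite defN !inE eqxx).
have [c4A e04] := mN c4 ltac:(by rewrite defN !inE eqxx orbT).
have mM c : c \in A :\: (c0 |: nbr A c0) -> [/\ c \in A, c0 != c & ~~ e c0 c].
  rewrite !inE negb_or negb_and => /andP[/andP[cc0 nc] cA].
  by rewrite cA eq_sym cc0; move: nc; rewrite cA.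
have [c2A d02 n02] := mM c2 ltac:(by rewrite defM !inE eqxx).
have [c3A d03 n03] := mM c3 ltac:(by rewrite defM !inE eqxx orbT).
have n14 : ~~ e c1 c4 := no_triangle cf c0A c1A c4A e01 e04.
have D x y z : e x z -> ~~ e x y -> z != y by move=> xz; apply: contraNneq => <-.
have d12 := D _ _ _ e01 n02; have d13 := D _ _ _ e01 n03.
have d42 := D _ _ _ e04 n02; have d43 := D _ _ _ e04 n03.
have e23 : e c2 c3.
  apply: contraLR al2 => n23; rewrite -ltnNge.
  by apply: (alpha_triple c0A c2A c3A); rewrite ?d02 ?d03 ?d23 ?n02 ?n03.
have H c : c \in A -> c1 != c -> c4 != c -> e c1 c || e c4 c.
  move=> cA d1 d4; apply: contraLR al2; rewrite negb_or => /andP[n1 n4].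
  by rewrite -ltnNge; apply: (alpha_triple c1A c4A cA); rewrite ?d14 ?d1 ?n14 ?n1.
have H1 : ~~ (e c1 c2 && e c1 c3).
  by apply/negP => /andP[e12 e13]; have := no_triangle cf c1A c2A c3A e12 e13; rewrite e23.
have H4 : ~~ (e c4 c2 && e c4 c3).
  by apply/negP => /andP[e12 e13]; have := no_triangle cf c4A c2A c3A e12 e13; rewrite e23.
have eA s : uniq s -> size s = 5 -> {subset s <= A} -> A = [set x in s].
  move=> us s5 sA; apply/eqP; rewrite eq_sym eqEcard A5 cardsE (card_uniqP us) s5 leqnn andbT.
  by apply/subsetP => x; rewrite inE; apply: sA.
have := H c2 c2A d12 d42; have := H c3 c3A d13 d43.
have fin a b c d : a \in A -> b \in A -> c \in A -> d \in A ->
    hole5 c0 a b c d -> is_hole5 A.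
  move=> aA bA cA dA h; exists c0, a, b, c, d; split=> //; apply: eA => //.
    exact: hole5_uniq h.
  by move=> x; rewrite !inE => /or4P[/eqP->|/eqP->|/eqP->|/orP[]/eqP->].
case E12: (e c1 c2) H1 => /= n13.
  rewrite (negPf n13) /= => e43; move: H4; rewrite e43 andbT => n42 _.
  apply: (fin c1 c2 c3 c4) => //.
  by rewrite /hole5 e01 E12 e23 (edge_sym c3) e43 (edge_sym c4) e04 n02 n13
    (edge_sym c2) n42 (edge_sym c3) n03 (edge_sym c4) n14.
move=> {n13} H13 e42; move: H4 H13; rewrite e42 /= => n43; rewrite (negPf n43) orbF => e13.
apply: (fin c1 c3 c2 c4) => //.
by rewrite /hole5 e01 e13 (edge_sym c3) e23 (edge_sym c2) e42 (edge_sym c4) e04 n03 E12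
    (edge_sym c3) n43 (edge_sym c2) n02 (edge_sym c4) n14.
Qed.

Lemma subset_card5 A C : C \subset A -> #|C| = 5 -> #|A| = 6 ->
  exists2 x, x \in A & A :\ x = C.
Proof.
move=> CA C5 A6; have /card_gt0P[x] : 0 < #|A :\: C| by rewrite cardsDS // A6 C5.
rewrite inE => /andP[xC xA]; exists x => //.
apply/eqP; rewrite eq_sym eqEcard subsetD1 CA xC /= C5.
by have := cardsD1 x A; rewrite xA A6; lia.
Qed.

(** Either five vertices already have positive gap, or the set is minimal and by parity contains a
    triangle K. The other three vertices then induce an edge and a non-edge, the alternatives being
    a split graph or a cover by two cliques, and two vertices of K complete them to a 5-hole. *)
Lemma excess_card6 A : excess 0 A -> #|A| = 6 ->
  exists2 x, x \in A & is_hole5 (A :\ x).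
Proof.
move=> xA A6; suff [C hC CA] : exists2 C, is_hole5 C & C \subset A.
  have [x xin E] := subset_card5 CA (hole5_card hC) A6.
  by exists x; rewrite // E.
have [B BA mB] := excess_minimal xA; have xB := minset_excess mB.
have := gap_bound_card gap_bound4 xB; rewrite leq_eqVlt => /orP[/eqP B5|B6].
  by exists B => //; apply: excess_card5.
have {B BA mB xB B6} mA : minset (excess 0) A.
  by have <- : B = A by apply/eqP; rewrite eqEcard BA A6.
have [cf|[K [cK KA cK3]]] := clique_free_dec 3 A.
  by have := gallai_minimal0 mA cf; rewrite A6; lia.
have cD : #|A :\: K| = 3 by rewrite cardsDS // A6 cK3.
have DA x : x \in A :\: K -> x \in A by rewrite inE => /andP[].
have tA := theta_D_clique A cK; have al2' := excess_alpha_gt1 xA.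
have nsD : ~~ is_stable (A :\: K).
  by apply/negP => /(split_no_excess 0 cK KA); rewrite xA.
have al2 : al A <= 2.
  by have := theta_lt_card nsD; move: xA; rewrite /excess cD; lia.
have ncD : ~~ is_clique (A :\: K).
  by apply/negP => /theta_clique; move: xA; rewrite /excess; lia.
have [d1 [d2 [d3 [d1D d2D d3D [e12 n13 d13] defD]]]] : exists d1 d2 d3,
    [/\ d1 \in A :\: K, d2 \in A :\: K, d3 \in A :\: K,
        [/\ e d1 d2, ~~ e d1 d3 & d1 != d3] & A :\: K = [set d1; d2] :|: [set d3]].
  have := nsD; rewrite negb_forall => /existsP[x]; rewrite negb_imply => /andP[xD].
  case/forall_inPn=> y yD; rewrite negbK => exy.
  have /card_gt0P[z] : 0 < #|(A :\: K) :\: [set x; y]|.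
    rewrite cardsDS ?cD ?cards2 ?(edge_neq exy) //.
    by apply/subsetP => u /set2P[]->.
  rewrite in_setD in_set2 negb_or => /andP[/andP[zx zy] zD].
  have defD : A :\: K = [set x; y] :|: [set z].
    apply/eqP; rewrite eq_sym eqEcard cD setUC cardsU1 cards2 (edge_neq exy).
    rewrite in_set2 negb_or zx zy /= andbT.
    by apply/subsetP => u /setU1P[->|/set2P[]->].
  have [exz|nxz] := boolP (e x z); last by exists x, y, z; rewrite eq_sym.
  have [eyz|nyz] := boolP (e y z); last first.
    by exists y, x, z; rewrite edge_sym eq_sym [[set y; x]]setUC.
  case/negP: ncD; rewrite defD setUC; apply: cliqueU1; first exact: clique2.
  by move=> u /set2P[]->; rewrite edge_sym.
have KD (t : G) : t \in K -> t \notin A :\: K by move=> tK; rewrite inE tK.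
have Kd (t d : G) : t \in K -> d \in A :\: K -> t != d.
  by move=> tK; apply: contraTneq => <-; apply: KD.
have K13 (t : G) : t \in K -> ~~ e t d1 -> e t d3.
  move=> tK n1; apply: contraLR al2 => n3; rewrite -ltnNge.
  apply: (alpha_triple (subsetP KA _ tK) (DA _ d1D) (DA _ d3D)).
    by rewrite (Kd t d1) // (Kd t d3).
  by rewrite n1 n3 n13.
(* If every vertex of K saw d2 or d3, the cliques {d1, d2} and {d3} would absorb K. *)
have [t1 t1K /andP[t1d3 t1d2]] : exists2 t : G, t \in K & ~~ e t d3 && ~~ e t d2.
  apply/exists_inP; apply: contraLR xA => /exists_inPn H.
  rewrite /excess -leqNgt addn0; apply: leq_trans al2'.
  have -> : A = K :|: \bigcup_(Q <- [:: [set d1; d2]; [set d3]]) Q.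
    by rewrite !big_cons big_nil setU0 -defD -{1}(setID A K) (setIidPr KA).
  apply: clique_absorb => //=; first by rewrite clique2 // clique1.
  move=> t tK; have := H t tK; rewrite negb_and !negbK => /orP[t3|t2].
    by exists [set d3]; rewrite ?inE ?eqxx ?orbT // => y /set1P->.
  have [t3|t3] := boolP (e t d3).
    by exists [set d3]; rewrite ?inE ?eqxx ?orbT // => y /set1P->.
  have t1 : e t d1 by apply: contraLR t3 => /(K13 t tK)->.
  by exists [set d1; d2]; rewrite ?inE ?eqxx ?orbT // => y /set2P[]->.
have t1d1 : e t1 d1 by apply: contraLR t1d3 => /(K13 t1 t1K)->.
have e23 : e d2 d3.
  apply: contraLR al2 => n23; rewrite -ltnNge.
  apply: (alpha_triple (subsetP KA _ t1K) (DA _ d2D) (DA _ d3D)).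
    rewrite (Kd t1 d2) // (Kd t1 d3) //=; apply: contraNneq n13 => <-; exact: e12.
  by rewrite t1d3 t1d2.
(* The same argument with the cliques {d2, d3} and {d1}. *)
have [t3 t3K /andP[t3d1 t3d2]] : exists2 t : G, t \in K & ~~ e t d1 && ~~ e t d2.
  apply/exists_inP; apply: contraLR xA => /exists_inPn H.
  rewrite /excess -leqNgt addn0; apply: leq_trans al2'.
  have -> : A = K :|: \bigcup_(Q <- [:: [set d2; d3]; [set d1]]) Q.
    have E : [set d2; d3] :|: [set d1] = A :\: K by rewrite defD setUC setUA.
    by rewrite !big_cons big_nil setU0 E -{1}(setID A K) (setIidPr KA).
  apply: clique_absorb => //=; first by rewrite clique2 // clique1.
  move=> t tK; have := H t tK; rewrite negb_and !negbK => t12.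
  have [td1|td1] := boolP (e t d1).
    by exists [set d1]; rewrite ?inE ?eqxx ?orbT // => y /set1P->.
  have td2 : e t d2 by move: t12; rewrite (negPf td1).
  have td3 := K13 t tK td1.
  by exists [set d2; d3]; rewrite ?inE ?eqxx ?orbT // => y /set2P[]->.
have t3d3 := K13 t3 t3K t3d1.
have t13 : e t3 t1.
  apply: (cliqueP _ cK) => //; apply: contraNneq t3d1 => ->; exact: t1d1.
exists [set x in [:: t1; d1; d2; d3; t3]].
  exists t1, d1, d2, d3, t3; split=> //.
  by rewrite /hole5 t1d1 e12 e23 (edge_sym d3) t3d3 t13 t1d2 n13 (edge_sym d2)
    t3d2 (edge_sym d3) t1d3.
apply/subsetP => x; rewrite !inE.
by case/or4P=> [/eqP->|/eqP->|/eqP->|/orP[]/eqP->];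
  rewrite ?(subsetP KA _ t1K) ?(subsetP KA _ t3K) ?DA.
Qed.

(** Three cliques cover a 5-hole. Two further vertices raise theta to 5 only if they are
    non-adjacent and neither sees the hole, since [hole5_absorb] adds such a vertex for free. *)
Lemma excess_card7 A : excess 0 A -> #|A| = 7 -> 4 < th A ->
  exists C, [/\ is_hole5 C, C \subset A, is_stable (A :\: C) & anticomplete (A :\: C) C].
Proof.
move=> xA A7 tA; suff [C hC CA] : exists2 C, is_hole5 C & C \subset A.
  have C5 := hole5_card hC.
  have cP : #|A :\: C| = 2 by rewrite cardsDS // A7 C5.
  exists C; split=> //.
    apply/negPn/negP => /theta_lt_card; rewrite cP.
    have := hole5_theta hC; have := thetaU (A :&: C) (A :\: C).
    by rewrite setID (setIidPr CA); lia.
  move=> p y pP yC; apply/negP => epy.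
  have := @hole5_absorb _ C p hC (ex_intro2 _ _ y yC epy).
  have := theta_card ((A :\: C) :\ p).
  have := thetaU (p |: C) ((A :\: C) :\ p).
  have -> : (p |: C) :|: ((A :\: C) :\ p) = A.
    rewrite [p |: C]setUC -setUA setD1K //.
    by rewrite -{2}(setID A C) (setIidPr CA).
  by have := cardsD1 p (A :\: C); rewrite pP cP; lia.
have [B BA mB] := excess_minimal xA; have xB := minset_excess mB.
have := gap_bound_card gap_bound4 xB; rewrite leq_eqVlt => /orP[/eqP B5|].
  by exists B => //; apply: excess_card5.
rewrite leq_eqVlt => /orP[/eqP B6|B7].
  have [x _ hC] := excess_card6 xB (esym B6); exists (B :\ x) => //.
  by apply: subset_trans BA; apply: subsetDl.
have {B BA mB xB B7} mA : minset (excess 0) A.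
  by have <- : B = A by apply/eqP; rewrite eqEcard BA A7.
have [cf|[K [cK KA cK3]]] := clique_free_dec 3 A.
  by have := gallai_minimal0 mA cf; rewrite A7; lia.
have cD : #|A :\: K| = 4 by rewrite cardsDS // A7 cK3.
have sD : is_stable (A :\: K).
  by apply/negPn/negP => /theta_lt_card; have := theta_D_clique A cK; lia.
by have := split_no_excess 0 cK KA sD; rewrite xA.
Qed.

Lemma cone_sub A K C P : is_clique K -> is_hole5 C -> is_stable P ->
  anticomplete P C -> K \subset A -> C \subset A :\: K -> P = (A :\: K) :\: C ->
  al A <= #|P| + 2 -> th A <= #|P| + 3.
Proof.
move=> cK hC sP aP KA CA defP.
have defD : C :|: P = A :\: K.
  by rewrite defP -{2}(setID (A :\: K) C) (setIidPr CA).
have -> : A = K :|: (C :|: P).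
  by rewrite defD -{1}(setID A K) (setIidPr KA).
apply: cone => //.
  by rewrite defP -setI_eq0 setDE -setIA [_ :&: C]setIC setICr setI0.
by rewrite defD -setI_eq0 setIDA setIC -setIDA setDv setI0.
Qed.

Lemma hole5_isolated D x : x \in D -> is_hole5 (D :\ x) -> 3 < th D ->
  anticomplete [set x] (D :\ x).
Proof.
move=> xD hC tD p y /set1P-> yC; apply/negP => epy.
by have := hole5_absorb hC (ex_intro2 _ _ y yC epy); rewrite setD1K //; lia.
Qed.

(** The five vertices are a 5-hole, and [cone_sub] with empty P gives theta at most 3, whereas alpha
    at least 2 and gap at least 2 demand 4. *)
Lemma excess1_hole A K : excess 1 A -> al A <= 2 -> is_clique K -> K \subset A ->
  #|A :\: K| = 5 -> False.
Proof.
move=> xA al2 cK KA cD; have alA := excess_alpha_gt1 xA.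
have hC : is_hole5 (A :\: K) by apply: excess_card5 => //; apply: excess_D xA.
have := @cone_sub A K (A :\: K) set0 cK hC.
rewrite setDv cards0 => H; have : th A <= 0 + 3.
  apply: H => //; first by apply/stableP => x y; rewrite inE.
  by move=> x y; rewrite inE.
by move: xA; rewrite /excess; lia.
Qed.

(** Here theta is 5 and alpha 3, so the six vertices are a 5-hole and a vertex without neighbours on
    it, and [cone_sub] with |P| = 1 gives theta at most 4. *)
Lemma excess1_hole_pendant A K : excess 1 A -> 2 < al A -> is_clique K ->
  K \subset A -> #|A :\: K| = 6 -> False.
Proof.
move=> xA al3 cK KA D6; have tD := theta_D_clique A cK.
have xD := excess_D cK xA.
have [x xin hC] := excess_card6 xD D6.
have tx := theta_D1 (A :\: K) x; have tC := hole5_theta hC.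
have := @cone_sub A K _ [set x] cK hC; rewrite cards1 => H.
have : th A <= 1 + 3.
  apply: H => //.
  - by apply/stableP => u v /set1P-> /set1P->; rewrite edge_irr.
  - by apply: hole5_isolated => //; move: xA; rewrite /excess; lia.
  - exact: subsetDl.
  - by rewrite setDDr setDv set0U; apply/esym/setIidPr; rewrite sub1set.
  - by move: xA; rewrite /excess; lia.
by move: xA; rewrite /excess; lia.
Qed.

Lemma gap_bound9 : gap_bound G 9 1.
Proof.
move=> A0 A09; rewrite leqNgt; apply/negP => /excess_minimal[A AA0 mA].
have xA := minset_excess mA.
have {A09 AA0 A0} A9 : #|A| <= 9 by apply: leq_trans (subset_leq_card AA0) A09.
have A5 := gap_bound_card gap_bound5 xA.
have alA := excess_alpha_gt1 xA.
have [cf|[K [cK KA cK3]]] := clique_free_dec 3 A.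
  have [E|[U [V [_ pU pV _ [cUV]]]]] := gallai_minimal mA cf.
    (* For 9 vertices alpha is at most 3, against R(3, 4) <= 9; for 7 it is at most 2, against R(3,
       3) <= 6. *)
    have := ramsey36 cf; have := ramsey49 cf.
    by move: xA; rewrite /excess; lia.
  (* Both parts would have gap 1 and hence five vertices each, 10 in all. *)
  have := minset_proper mA pU; have := minset_proper mA pV.
  have := @gap_bound4 U; have := @gap_bound4 V.
  by move: xA; rewrite /excess; lia.
have xD := excess_D cK xA.
have cD : #|A :\: K| = #|A| - 3 by rewrite cardsDS // cK3.
have D5 := gap_bound_card gap_bound4 xD.
have [al2|al3] := leqP (al A) 2.
  (* |A| is 8 or 9, and the Ramsey bounds in the complement give a clique on 3 or 4 vertices, so
     that exactly five are left. *)
  have [L [cL LA cL_]] : exists L, [/\ is_clique L, L \subset A & #|L| = #|A| - 5].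
    have [A8|A8] := eqVneq #|A| 8.
      by rewrite A8; apply: ramsey_clique (@ramsey36 _) al2 _; rewrite A8.
    have -> : #|A| = 9 by lia.
    by apply: ramsey_clique (@ramsey49 _) al2 _; lia.
  by apply: (excess1_hole xA al2 cL LA); rewrite cardsDS // cL_; lia.
have tD := theta_D_clique A cK.
have [D5'|D6] := eqVneq #|A :\: K| 5.
  by have := hole5_theta (excess_card5 xD D5'); move: xA; rewrite /excess; lia.
by apply: (excess1_hole_pendant xA al3 cK KA); lia.
Qed.

End AtMostNine.

(** * Gap two on ten vertices *)

Section Ten.

Variable G : sgraph.
Implicit Types (A B K S U C D P Q : {set G}) (x y z k p q v w : G) (n t : nat).

Notation e := (@edge G).

(** Here theta is 6 and alpha 4, so the seven vertices are a 5-hole and two vertices isolated among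
    them, and [cone_sub] with |P| = 2 gives theta at most 5. *)
Lemma excess1_alpha4 A K : excess 1 A -> 3 < al A -> is_clique K ->
  K \subset A -> #|A :\: K| = 7 -> False.
Proof.
move=> xA al4 cK KA D7; have tD := theta_D_clique A cK.
have xD := excess_D cK xA.
have [|C [hC CD sP aP]] := excess_card7 xD D7; first by move: xA; rewrite /excess; lia.
have cP : #|(A :\: K) :\: C| = 2 by rewrite cardsDS // D7 (hole5_card hC).
have tC := hole5_theta hC; have tP := theta_card ((A :\: K) :\: C).
have tDC : th (A :\: K) <= th C + th ((A :\: K) :\: C).
  by apply: theta_subU; rewrite -{1}(setID (A :\: K) C) (setIidPr CD).
have := @cone_sub _ A K C _ cK hC sP aP KA CD erefl; rewrite cP => H.
have : th A <= 2 + 3 by apply: H; move: xA; rewrite /excess; lia.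
by move: xA; rewrite /excess; lia.
Qed.

(** x can join a clique containing none of its non-neighbours. Every other clique uses up one of the
    fewer than m non-neighbours, so one of the m cliques is free. *)
Lemma covered_nonnbr (m : nat) B x : x \notin B -> covered m B ->
  #|[set y in B | ~~ e x y]| < m -> covered m (x |: B).
Proof.
elim: m B => [//|m IH] B xB /= /existsP[K /andP[cK cB]] lt.
case: (boolP [forall y in B :&: K, e x y]) => [/forall_inP xK|].
  apply/existsP; exists (x |: (B :&: K)); apply/andP; split.
    by apply: cliqueU1 => //; apply: cliqueS cK; apply: subsetIr.
  apply: coveredS cB; apply/subsetP => z; rewrite !inE negb_or negb_and.
  case/andP=> /andP[zx H] /orP[/eqP E|zB]; first by rewrite E eqxx in zx.
  by rewrite zB andbT; rewrite zB in H.
case/forall_inPn=> y; rewrite inE => /andP[yB yK] nxy.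
apply/existsP; exists (K :\ x); apply/andP; split.
  by apply: cliqueS cK; apply: subsetDl.
apply: (@coveredS _ _ (x |: (B :\: K))).
  apply/subsetP => z; rewrite !inE; case: eqVneq => //= zx /andP[-> ->] //.
apply: IH => //; first by rewrite !inE (negPf xB) andbF.
rewrite -ltnS; apply: leq_trans lt; apply: proper_card; apply/properP; split.
  by apply/subsetP => z; rewrite !inE => /andP[/andP[_ ->] ->].
by exists y; rewrite !inE ?yB ?yK.
Qed.

Lemma theta_nonnbr A x : x \in A -> th (A :\ x) < th A ->
  th (A :\ x) <= #|[set y in A :\ x | ~~ e x y]|.
Proof.
move=> xA lt; rewrite leqNgt; apply/negP => H.
have : covered (th (A :\ x)) (x |: A :\ x).
  by apply: covered_nonnbr H; rewrite ?setD11 // -theta_le.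
by rewrite setD1K // -theta_le leqNgt lt.
Qed.

Lemma hole5_rot c0 c1 c2 c3 c4 : hole5 c0 c1 c2 c3 c4 -> hole5 c1 c2 c3 c4 (c0 : G).
Proof.
case/andP=> /and5P[e01 e12 e23 e34 e40] /and5P[n02 n13 n24 n30 n41].
by rewrite /hole5 e12 e23 e34 e40 e01 n13 n24 n30 n41 n02.
Qed.

Lemma card_sub_seq B (s : seq G) : uniq s -> {subset B <= s} ->
  #|B| = count [in B] s.
Proof.
move=> us Bs; rewrite -size_filter -(card_uniqP (filter_uniq _ us)).
by apply: eq_card => x; rewrite mem_filter; case: (boolP (x \in B)) => // /Bs->.
Qed.

Lemma hole5_clique C B : is_hole5 C -> is_clique B -> B \subset C -> #|B| <= 2.
Proof.
move=> [c0 [c1 [c2 [c3 [c4 [h ->]]]]]] /cliqueP cB /subsetP BC.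
have us := hole5_uniq h; rewrite (card_sub_seq us) /=; last first.
  by move=> x /BC; rewrite inE.
have D x y : x != y -> ~~ e x y -> (x \in B) + (y \in B) <= 1.
  move=> nxy; apply: contraR; case: (boolP (x \in B)) => //= xB; last by case: (_ \in _).
  by case: (boolP (y \in B)) => //= yB _; apply: cB.
move: us; rewrite /= !inE !negb_or => /and5P[/and4P[_ d02 d03 _] /and3P[_ d13 d14]].
case/andP=> _ d24 _ _; case/andP: h => _ /and5P[n02 n13 n24 n30 n41].
rewrite edge_sym in n30; rewrite edge_sym in n41.
move: (D _ _ d02 n02) (D _ _ d13 n13) (D _ _ d24 n24) (D _ _ d03 n30) (D _ _ d14 n41).
by case: (c0 \in B); case: (c1 \in B); case: (c2 \in B); case: (c3 \in B);
  case: (c4 \in B).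
Qed.

(* The complementary statement: a triangle-free graph on ten vertices is 3-colourable. *)
Lemma excess1_alpha2 A : minset (excess 1) A -> al A <= 2 -> #|A| = 10 -> False.
Proof.
move=> mA al2 A10; have xA := minset_excess mA.
have al2' := excess_alpha_gt1 xA.
have trip x y z : x \in A -> y \in A -> z \in A -> x != y -> x != z -> y != z ->
    ~~ e x y -> ~~ e x z -> e y z.
  move=> xin yin zin xy xz yz nxy nxz; apply: contraLR al2 => nyz.
  by rewrite -ltnNge; apply: (alpha_triple xin yin zin); rewrite ?xy ?xz ?yz ?nxy ?nxz.
(* R(3, 4) <= 9 in the complement. The other six vertices are a 5-hole C and a vertex w. *)
have [K [cK KA K4]] : exists K, [/\ is_clique K, K \subset A & #|K| = 4].
  by apply: ramsey_clique (@ramsey49 _) al2 _; rewrite A10.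
have D6 : #|A :\: K| = 6 by rewrite cardsDS // A10 K4.
have xD := excess_D cK xA.
have [w wD hC] := excess_card6 xD D6.
move defC : ((A :\: K) :\ w) hC => C hC.
have CD c : c \in C -> [/\ c \in A, c \notin K & c != w].
  by rewrite -defC !inE => /and3P[-> -> ->].
have [wA wK] : w \in A /\ w \notin K by move: wD; rewrite inE => /andP[].
have inA x : x \in A -> [|| x \in K, x == w | x \in C].
  by rewrite -defC !inE => ->; case: (x \in K); case: (x == w).
have kc k c : k \in K -> c \notin K -> k != c by move=> kK; apply: contraNneq => <-.
have ck k c : k \in K -> c \notin K -> c != k by move=> kK cK'; rewrite eq_sym kc.
have tA : 3 < th A by move: xA; rewrite /excess; lia.
have L k a b : k \in K -> a \in C -> b \in C -> a != b -> ~~ e a b ->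
    ~~ e k a -> e k b.
  move=> kK aC bC ab nab nka.
  have [aA aK _] := CD a aC; have [bA bK _] := CD b bC.
  have nak : ~~ e a k by rewrite edge_sym.
  exact: (trip a k b aA (subsetP KA _ kK) bA (ck _ _ kK aK) ab (kc _ _ kK bK) nak nab).
case: (hC) => [c0 [c1 [c2 [c3 [c4 [h defC']]]]]].
have Cin : all [in C] [:: c0; c1; c2; c3; c4].
  by rewrite defC' /= !inE !eqxx !orbT.
(* The non-neighbours of k are pairwise adjacent as alpha is 2. If k saw w, they would all lie on C
   and be at most two, but criticality of k demands at least three. *)
have kw k : k \in K -> ~~ e k w.
  move=> kK; have kA := subsetP KA _ kK; apply/negP => ekw.
  have lt := minimal_critical mA kA.
  suff N2 : #|[set y in A :\ k | ~~ e k y]| < 3.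
    by have := leq_trans tA (leq_trans (theta_D1 A k) (leq_ltn_trans (theta_nonnbr kA lt) N2)).
  rewrite ltnNge; apply/negP => /subset_of_card[B /subsetP BN B3].
  have BC : B \subset C.
    apply/subsetP => y /BN; rewrite !inE => /andP[/andP[yk yA] nky].
    have /or3P[yK|/eqP yw|//] := inA y yA; last by rewrite yw ekw in nky.
    by rewrite (cliqueP _ cK k y) // eq_sym in nky.
  have cB : is_clique B.
    apply/cliqueP => x y xB yB nxy.
    have := BN x xB; have := BN y yB; rewrite !inE => /andP[/andP[yk yA] nky].
    case/andP=> /andP[xk xA'] nkx.
    by rewrite eq_sym in xk; rewrite eq_sym in yk; apply: (trip k x y).
  by have := hole5_clique hC cB BC; rewrite B3.
(* The cliques {d0, w}, {d1, d2}, {d3, d4} would absorb K, each k being complete to one of the last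
   two. *)
have try0 d0 d1 d2 d3 d4 : hole5 d0 d1 d2 d3 d4 ->
    C = [set x in [:: d0; d1; d2; d3; d4]] -> e w d0 ->
    {in K, forall k, e k d2 || e k d3} -> False.
  move=> hd defd wd0 Kd.
  have [d0C d1C d2C d3C d4C] : [/\ d0 \in C, d1 \in C, d2 \in C, d3 \in C & d4 \in C].
    by rewrite defd !inE !eqxx !orbT.
  have := hole5_uniq hd; rewrite /= !inE !negb_or.
  case/and5P=> _ /and3P[_ d13 d14] /andP[_ d24] _ _.
  case/andP: hd => /and5P[_ e12 _ e34 _] /and5P[n02 n13 n24 n30 n41].
  suff : th A <= 3 by rewrite leqNgt tA.
  have -> : A = K :|: \bigcup_(Q <- [:: [set d0; w]; [set d1; d2]; [set d3; d4]]) Q.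
    apply/eqP; rewrite eqEsubset !big_cons big_nil setU0; apply/andP; split.
      apply/subsetP => x /inA; rewrite defd !inE.
      by case/or3P=> [->//|->|]; rewrite ?orbT //;
        case/or4P=> [|||/orP[]] ->; rewrite ?orbT.
    apply/subsetP => x; rewrite !inE => /orP[/(subsetP KA)//|].
    case/or3P=> /orP[]/eqP-> //.
    - by case: (CD d0).
    - by case: (CD d1).
    - by case: (CD d2).
    - by case: (CD d3).
    - by case: (CD d4).
  apply: clique_absorb => //=.
    by rewrite clique2 ?clique2 // edge_sym.
  have Q2 k : e k d1 -> e k d2 ->
      exists2 Q, Q \in [:: [set d0; w]; [set d1; d2]; [set d3; d4]] &
        {in Q, forall y, e k y}.
    by exists [set d1; d2]; rewrite ?inE ?eqxx ?orbT // => y /set2P[]->.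
  have Q3 k : e k d3 -> e k d4 ->
      exists2 Q, Q \in [:: [set d0; w]; [set d1; d2]; [set d3; d4]] &
        {in Q, forall y, e k y}.
    by exists [set d3; d4]; rewrite ?inE ?eqxx ?orbT // => y /set2P[]->.
  move=> k kK; have [k1|k1] := boolP (e k d1).
    have [k2|k2] := boolP (e k d2); first exact: Q2.
    have k3 : e k d3 by have := Kd k kK; rewrite (negPf k2).
    by apply: Q3 => //; apply: (L k d2).
  by apply: Q3; apply: (L k d1); rewrite // edge_sym.
(* If w misses d0, then w sees d2, and every k sees d0 because w misses both. So [try0] applies to
   the hole rotated by two. *)
have nobad d0 d1 d2 d3 d4 : hole5 d0 d1 d2 d3 d4 ->
    C = [set x in [:: d0; d1; d2; d3; d4]] ->
    ~ {in K, forall k, e k d2 || e k d3}.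
  move=> hd defd Kd; have [wd0|wd0] := boolP (e w d0).
    exact: (try0 _ _ _ _ _ hd defd).
  have [d0C d2C] : d0 \in C /\ d2 \in C by rewrite defd !inE !eqxx !orbT.
  have [d0A d0K d0w] := CD _ d0C; have [d2A d2K d2w] := CD _ d2C.
  apply: (try0 _ _ _ _ _ (hole5_rot (hole5_rot hd))).
  - by rewrite defd; apply/setP => x; rewrite !in_set -(mem_rot 2).
  - case/andP: hd (hole5_uniq hd) => _ /andP[n02 _] /andP[u _].
    move: u; rewrite !inE !negb_or => /and3P[_ d02 _].
    have n0w : ~~ e d0 w by rewrite edge_sym.
    rewrite eq_sym in d2w.
    exact: (trip d0 w d2 d0A wA d2A d0w d02 d2w n0w n02).
  move=> k kK; apply/orP; right; have nwk : ~~ e w k by rewrite edge_sym kw.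
  rewrite eq_sym in d0w.
  exact: (trip w k d0 wA (subsetP KA _ kK) d0A (ck _ _ kK wK) d0w (kc _ _ kK d0K)).
have bad d0 d1 d2 d3 d4 : hole5 d0 d1 d2 d3 d4 ->
    C = [set x in [:: d0; d1; d2; d3; d4]] ->
    exists k, [/\ k \in K, ~~ e k d2 & ~~ e k d3].
  move=> hd defd; case: (boolP [forall k in K, e k d2 || e k d3]) => [/forall_inP|].
    by move/(nobad _ _ _ _ _ hd defd).
  by case/forall_inPn=> k kK; rewrite negb_or => /andP[]; exists k.
have rotE d0 d1 d2 d3 d4 : C = [set x in [:: d0; d1; d2; d3; d4]] ->
    C = [set x in [:: d1; d2; d3; d4; d0]].
  by move=> ->; apply/setP => x; rewrite !in_set -(mem_rot 1).
have h1 := hole5_rot h; have E1 := rotE _ _ _ _ _ defC'.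
have h2 := hole5_rot h1; have E2 := rotE _ _ _ _ _ E1.
have h3 := hole5_rot h2; have E3 := rotE _ _ _ _ _ E2.
have h4 := hole5_rot h3; have E4 := rotE _ _ _ _ _ E3.
have [k0 [k0K k02 k03]] := bad _ _ _ _ _ h defC'.
have [k1 [k1K k13 k14]] := bad _ _ _ _ _ h1 E1.
have [k2 [k2K k24 k20]] := bad _ _ _ _ _ h2 E2.
have [k3 [k3K k30 k31]] := bad _ _ _ _ _ h3 E3.
have [k4 [k4K k41 k42]] := bad _ _ _ _ _ h4 E4.
(* No k misses two non-adjacent vertices of the hole, so the five vertices found for its five edges
   are distinct, too many for K. *)
have sep k k' a b : k \in K -> a \in C -> b \in C -> a != b -> ~~ e a b ->
    ~~ e k a -> ~~ e k' b -> k != k'.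
  move=> kK aC bC ab nab nka; apply: contraNneq => <-.
  exact: L ab nab nka.
have [c0C c1C c2C c3C c4C] : [/\ c0 \in C, c1 \in C, c2 \in C, c3 \in C & c4 \in C].
  by rewrite defC' !inE !eqxx !orbT.
have := hole5_uniq h; rewrite /= !inE !negb_or.
case/and5P=> /and4P[_ d02 d03 _] /and3P[_ d13 d14] /andP[_ d24] _ _.
case/andP: h => _ /and5P[n02 n13 n24 n30 n41].
have n42 : ~~ e c4 c2 by rewrite edge_sym.
have n03 : ~~ e c0 c3 by rewrite edge_sym.
have n31 : ~~ e c3 c1 by rewrite edge_sym.
have n14 : ~~ e c1 c4 by rewrite edge_sym.
have n20 : ~~ e c2 c0 by rewrite edge_sym.
have d42 : c4 != c2 by rewrite eq_sym.
have d30 : c3 != c0 by rewrite eq_sym.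
have d31 : c3 != c1 by rewrite eq_sym.
have d41 : c4 != c1 by rewrite eq_sym.
have : uniq [:: k0; k1; k2; k3; k4].
  rewrite /= !inE !negb_or !andbT.
  rewrite (sep k0 k1 c2 c4) // (sep k0 k2 c2 c4) // (sep k0 k3 c3 c0) //.
  rewrite (sep k0 k4 c3 c1) // (sep k1 k2 c3 c0) // (sep k1 k3 c3 c0) //.
  rewrite (sep k1 k4 c3 c1) // (sep k2 k3 c4 c1) // (sep k2 k4 c4 c1) //.
  by rewrite (sep k3 k4 c0 c2).
move/card_uniqP=> /= u5; suff : 5 <= #|K| by rewrite K4.
rewrite -u5; apply: subset_leq_card; apply/subsetP => x.
by rewrite !inE; case/or4P=> [|||/orP[]] /eqP->.
Qed.

End Ten.

(** * Ten vertices with stability number three *)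

Section TenAlphaThree.

Variable G : sgraph.
Implicit Types (A B K L S U C D P Q W : {set G}) (x y z k p q v w : G).

Notation e := (@edge G).
Notation ind := (@co_edge G).

Lemma stable4 A x y z w : al A <= 3 -> {subset [:: x; y; z; w] <= A} ->
  ~ [&& ind x y, ind x z, ind x w, ind y z, ind y w & ind z w].
Proof.
move=> al3 sA /and5P[xy xz xw yz /andP[yw zw]].
have := @alpha_seq _ A _ sA; rewrite /= -/(ind x y) -/(ind x z) -/(ind x w).
rewrite -/(ind y z) -/(ind y w) -/(ind z w) xy xz xw yz yw zw => /(_ isT).
by rewrite ltnNge al3.
Qed.

Lemma clique4 A x y z w : clique_free 4 A -> {subset [:: x; y; z; w] <= A} ->
  ~ [&& e x y, e x z, e x w, e y z, e y w & e z w].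
Proof.
move=> cf sA /and5P[xy xz xw yz /andP[yw zw]].
have := clique_free_seq cf sA; rewrite /= xy xz xw yz yw zw => /(_ isT).
by rewrite ltnn.
Qed.

Lemma triangle_set x y z : e x y -> e x z -> e y z ->
  is_clique [set x; y; z] /\ #|[set x; y; z]| = 3.
Proof.
move=> xy xz yz; have us : uniq [:: x; y; z].
  by rewrite /= !inE !negb_or (edge_neq xy) (edge_neq xz) (edge_neq yz).
have -> : [set x; y; z] = [set u in [:: x; y; z]].
  by apply/setP => u; rewrite !inE orbA.
by rewrite cardsE (card_uniqP us); split=> //; apply: clique_seq; rewrite /= xy xz yz.
Qed.

Definition meeting_triangles A := forall K L : {set G},
  is_clique K -> is_clique L -> K \subset A -> L \subset A -> #|K| = 3 -> #|L| = 3 ->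
  exists x, x \in K :&: L.

Lemma meeting_seq A x y z u v w : meeting_triangles A ->
  {subset [:: x; y; z; u; v; w] <= A} -> e x y -> e x z -> e y z ->
  e u v -> e u w -> e v w -> has [in [:: u; v; w]] [:: x; y; z].
Proof.
move=> m sA xy xz yz uv uw vw.
have [cK K3] := triangle_set xy xz yz; have [cL L3] := triangle_set uv uw vw.
have [||t] := m _ _ cK cL _ _ K3 L3.
- apply/subsetP => t; rewrite !inE => /orP[/orP[]|] /eqP->; apply: sA;
  by rewrite !inE eqxx ?orbT.
- apply/subsetP => t; rewrite !inE => /orP[/orP[]|] /eqP->; apply: sA;
  by rewrite !inE eqxx ?orbT.
rewrite in_setI => /andP[tK tL]; apply/hasP; exists t.
  by move: tK; rewrite !inE orbA.
by move: tL; rewrite /= !inE orbA.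
Qed.

Lemma ord3_third (i j : 'I_3) : exists l, (l != i) && (l != j).
Proof.
have i3 := ltn_ord i; have j3 := ltn_ord j.
have [H0|] := boolP ((i != 0 :> nat) && (j != 0 :> nat)).
  by exists (@Ordinal 3 0 isT); rewrite -!val_eqE /=; lia.
have [H1 _|] := boolP ((i != 1 :> nat) && (j != 1 :> nat)).
  by exists (@Ordinal 3 1 isT); rewrite -!val_eqE /=; lia.
by move=> H1 H0; exists (@Ordinal 3 2 isT); rewrite -!val_eqE /=; lia.
Qed.

Lemma ord3_or (i j l m : 'I_3) : i != j -> l != i -> l != j -> m != l ->
  (m == i) || (m == j).
Proof.
rewrite -!val_eqE /=; have := ltn_ord i; have := ltn_ord j; have := ltn_ord l.
by have := ltn_ord m; lia.
Qed.

Lemma third x y K : #|K| = 3 -> exists z, [/\ z \in K, z != x & z != y].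
Proof.
move=> K3; have : 0 < #|K :\: [set x; y]|.
  have := cardsID [set x; y] K; have := subset_leq_card (subsetIr K [set x; y]).
  by rewrite cards2; lia.
by case/card_gt0P=> z; rewrite !inE negb_or => /andP[/andP[zx zy] zK]; exists z.
Qed.

(* [a] and [y] are the inner triangle and the tips of a 3-sun. *)
Lemma no_sun A (a y : 'I_3 -> G) : #|A| = 10 -> al A <= 3 ->
  meeting_triangles A -> (forall i, a i \in A) -> (forall i, y i \in A) ->
  injective y ->
  (forall i j, i != j -> e (a i) (a j)) -> (forall i j, i != j -> e (a i) (y j)) ->
  (forall i, ~~ e (a i) (y i)) -> (forall i j, ~~ e (y i) (y j)) -> False.
Proof.
move=> A10 al3 mt aA yA yI eaa eay nay nyy.
have aI : injective a.
  move=> i j aij; apply/eqP/negPn/negP => /eaa; by rewrite aij edge_irr.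
have ay i j : a i != y j.
  have [->|nij] := eqVneq i j; last exact: edge_neq (eay _ _ nij).
  have [l /andP[lj _]] := ord3_third j j.
  apply: contraNneq (nyy j l) => <-; apply: eay; by rewrite eq_sym.
pose Aa := [set a i | i : 'I_3]; pose Y := [set y i | i : 'I_3].
pose W := (A :\: Aa) :\: Y.
have AaA : Aa \subset A by apply/subsetP => _ /imsetP[i _ ->].
have YA : Y \subset A :\: Aa.
  apply/subsetP => _ /imsetP[i _ ->]; rewrite inE yA andbT.
  by apply/imsetP => -[j _ yj]; have := ay j i; rewrite yj eqxx.
have W4 : #|W| = 4 by rewrite !cardsDS // !card_imset // card_ord A10.
have inW w : w \in W -> [/\ w \in A, w \notin Aa, forall i, w != a i & forall i, w != y i].
  rewrite !in_setD => /and3P[wY wAa wA]; split=> // i.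
    by apply: contraNneq wAa => ->; apply: imset_f.
  by apply: contraNneq wY => ->; apply: imset_f.
pose i0 := @Ordinal 3 0 isT; pose i1 := @Ordinal 3 1 isT; pose i2 := @Ordinal 3 2 isT.
(* A triangle off [Aa] would be disjoint from the inner triangle. *)
have tri0 x u v : x \in A -> u \in A -> v \in A -> x \notin Aa -> u \notin Aa ->
    v \notin Aa -> e x u -> e x v -> ~~ e u v.
  move=> xA uA vA xa ua va xu xv; apply/negP => uv.
  have := @meeting_seq A x u v (a i0) (a i1) (a i2) mt.
  move=> /(_ _ xu xv uv (eaa i0 i1 isT) (eaa i0 i2 isT) (eaa i1 i2 isT)) H.
  have /hasP[t] : has [in [:: a i0; a i1; a i2]] [:: x; u; v].
    by apply: H => t; rewrite !inE; do 5 (case/orP=> [/eqP-> //|]); move/eqP->.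
  move=> t1 t2; have {t2} tAa : t \in Aa.
    by move: t2; rewrite !inE => /or3P[]/eqP->; apply: imset_f.
  move: t1; rewrite !inE => /or3P[] /eqP E; rewrite E in tAa.
  - by rewrite tAa in xa.
  - by rewrite tAa in ua.
  - by rewrite tAa in va.
have yAa i : y i \notin Aa.
  have yY : y i \in Y by apply: imset_f.
  by have := subsetP YA _ yY; rewrite inE => /andP[].
(* Otherwise the triangles {w, a i, y j} and {a j, a l, y i} would be disjoint. *)
have wa w i j : w \in W -> e w (a i) -> j != i -> ~~ e w (y j).
  move=> wW ewa ji; have [wA _ wna wny] := inW w wW; apply/negP => ewy.
  have [l /andP[li lj]] := ord3_third i j.
  have := @meeting_seq A w (a i) (y j) (a j) (a l) (y i) mt.
  have ij : i != j by rewrite eq_sym.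
  have jl : j != l by rewrite eq_sym.
  move=> /(_ _ ewa ewy (eay _ _ ij) (eaa _ _ jl) (eay _ _ ji) (eay _ _ li)) H.
  have : has [in [:: a j; a l; y i]] [:: w; a i; y j].
    by apply: H => t; rewrite !inE; do 5 (case/orP=> [/eqP-> //|]); move/eqP->.
  rewrite /= !inE !(negPf (wna _)) !(negPf (wny _)) !(inj_eq aI) !(inj_eq yI).
  by rewrite (negPf ij) (negPf ji) [i == l]eq_sym (negPf li) (negPf (ay _ _))
    ![y j == _]eq_sym !(negPf (ay _ _)).
have in4 x u v w : x \in A -> u \in A -> v \in A -> w \in A ->
    {subset [:: x; u; v; w] <= A}.
  by move=> xA uA vA wA t; rewrite !inE => /or4P[]/eqP->.
have indyy i j : i != j -> ind (y i) (y j).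
  by move=> nij; rewrite /co_edge (inj_eq yI) nij nyy.
have indwy w i : w \in W -> ~~ e w (y i) -> ind w (y i).
  by move=> /inW[_ _ _ wy] nwy; rewrite /co_edge wy.
have indyw w i : w \in W -> ~~ e w (y i) -> ind (y i) w.
  by move=> /inW[_ _ _ wy] nwy; rewrite /co_edge eq_sym wy edge_sym.
have indaw w i : w \in W -> ~~ e w (a i) -> ind (a i) w.
  by move=> /inW[_ _ wna _] nwa; rewrite /co_edge eq_sym wna edge_sym.
have cov w : w \in W -> exists i, e w (y i).
  move=> wW; case: (boolP [exists i, e w (y i)]) => [/existsP//|/existsPn H].
  have [wA _ _ _] := inW w wW.
  by exfalso; apply: (stable4 al3 (in4 _ _ _ _ wA (yA i0) (yA i1) (yA i2)));
    rewrite !(indwy w) // !indyy.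
(* [y i] is the only tip seen by w. Each of the four vertices of W sees a tip; those with a unique
   one will form [PS], those with several [NP]. *)
pose priv w i := e w (y i) && [forall j, (j != i) ==> ~~ e w (y j)].
have privN w i j : priv w i -> j != i -> ~~ e w (y j).
  by case/andP=> _ /forallP/(_ j)/implyP H /H.
have privY w i : priv w i -> e w (y i) by case/andP.
have privA w i j : w \in W -> priv w i -> j != i -> ~~ e w (a j).
  move=> wW pw ji; apply/negP => ewa.
  by have := wa w j i wW ewa; rewrite eq_sym ji privY // => /(_ isT).
have P1 w w' i : w \in W -> w' \in W -> priv w i -> priv w' i -> w = w'.
  move=> wW wW' pw pw'; apply/eqP/negPn/negP => nww.
  have [wA wAa _ _] := inW w wW; have [wA' wAa' _ _] := inW w' wW'.
  have nww' : ~~ e w w'.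
    by apply: (tri0 (y i)) => //; rewrite edge_sym privY.
  have [j /andP[ji _]] := ord3_third i i.
  have [l /andP[li lj]] := ord3_third i j.
  have jl : j != l by rewrite eq_sym.
  apply: (stable4 al3 (in4 _ _ _ _ wA wA' (yA j) (yA l))).
  rewrite {1}/co_edge nww nww' !(indwy w) ?(privN w i) // !(indwy w') ?(privN w' i) //.
  exact: indyy.
pose NP := [set w in W | [forall i, ~~ priv w i]].
have NPW w : w \in NP -> w \in W by rewrite inE => /andP[].
have NPN w i : w \in NP -> ~~ priv w i by rewrite inE => /andP[_ /forallP].
have NPtwo w : w \in NP -> exists i j, [/\ i != j, e w (y i) & e w (y j)].
  move=> wN; have [i wi] := cov w (NPW _ wN).
  have := NPN w i wN; rewrite /priv wi /= => /forallPn[j].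
  by rewrite negb_imply negbK => /andP[ji wj]; exists i, j; rewrite eq_sym.
have NPa w i : w \in NP -> ~~ e w (a i).
  move=> wN; apply/negP => ewa; have wW := NPW w wN; have := NPN w i wN.
  have [j wj] := cov w wW; have ij : j = i.
    by apply/eqP/negPn/negP => ji; have := wa w i j wW ewa ji; rewrite wj.
  rewrite /priv -ij wj /= => /forallPn[l]; rewrite negb_imply negbK => /andP[lj wl].
  by have := wa w i l wW ewa; rewrite -ij lj wl => /(_ isT).
(* Two vertices seeing at least two of the three tips each have a tip in common, and adjacency would
   make a triangle off [Aa]. *)
have NP2 w w' : w \in NP -> w' \in NP -> ~~ e w w'.
  move=> wN wN'; have [i [j [ij wi wj]]] := NPtwo w wN.
  have [i' [j' [ij' wi' wj']]] := NPtwo w' wN'.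
  have [l /andP[li lj]] := ord3_third i j.
  have [m ml wm] : exists2 m, m != l & e w' (y m).
    have [E|ne] := eqVneq i' l; last by exists i'.
    by exists j'; rewrite // -E eq_sym.
  have [wA wAa _ _] := inW w (NPW w wN); have [wA' wAa' _ _] := inW w' (NPW w' wN').
  have wm' : e w (y m) by have /orP[] := ord3_or ij li lj ml => /eqP->.
  by apply: (tri0 (y m)) => //; rewrite edge_sym.
have NPle2 : #|NP| <= 2.
  rewrite leqNgt; apply/negP => /card_gt2P[x [u [v [[xN uN vN] [xu uv vx]]]]].
  have [xA _ _ _] := inW x (NPW x xN); have [uA _ _ _] := inW u (NPW u uN).
  have [vA _ _ _] := inW v (NPW v vN).
  apply: (stable4 al3 (in4 _ _ _ _ (aA i0) xA uA vA)).
  by rewrite (indaw x) ?NPa ?NPW // (indaw u) ?NPa ?NPW // (indaw v) ?NPa ?NPW //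
    /co_edge xu uv [x == v]eq_sym vx !NP2 //.
pose PS := W :\: NP.
have PSW w : w \in PS -> w \in W by rewrite inE => /andP[].
have PSi w : w \in PS -> exists i, priv w i.
  rewrite in_setD => /andP[wNP wW]; move: wNP; rewrite in_set wW /=.
  by case/forallPn=> i; rewrite negbK; exists i.
(* Otherwise w, w' and [a l], [y l], for l the remaining index, would be stable. *)
have PP w w' i i' : w \in W -> w' \in W -> priv w i -> priv w' i' -> w != w' -> e w w'.
  move=> wW wW' pw pw' nww; apply/negPn/negP => eww.
  have ii : i != i' by apply: contraNneq nww => E; rewrite E in pw; rewrite (P1 w w' i').
  have [wA wAa _ _] := inW w wW; have [wA' wAa' _ _] := inW w' wW'.
  have [l /andP[li lj]] := ord3_third i i'.
  apply: (stable4 al3 (in4 _ _ _ _ (aA l) (yA l) wA wA')).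
  rewrite {1}/co_edge ay nay (indaw w) ?(privA w i) // (indaw w') ?(privA w' i') //=.
  rewrite (indyw w) ?(privN w i) // (indyw w') ?(privN w' i') //=.
  by rewrite /co_edge nww.
have PSle2 : #|PS| <= 2.
  rewrite leqNgt; apply/negP => /card_gt2P[x [u [v [[xN uN vN] [xu uv vx]]]]].
  have [i px] := PSi x xN; have [j pu] := PSi u uN; have [l pv] := PSi v vN.
  have [xA xAa _ _] := inW x (PSW x xN); have [uA uAa _ _] := inW u (PSW u uN).
  have [vA vAa _ _] := inW v (PSW v vN).
  have exu := PP _ _ _ _ (PSW x xN) (PSW u uN) px pu xu.
  have euv := PP _ _ _ _ (PSW u uN) (PSW v vN) pu pv uv.
  have evx := PP _ _ _ _ (PSW v vN) (PSW x xN) pv px vx.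
  by have := tri0 x u v xA uA vA xAa uAa vAa exu; rewrite edge_sym evx euv => /(_ isT).
have cPS : #|PS| + #|NP| = 4.
  rewrite -W4 cardsDS ?subnK //; last by apply/subsetP => w /NPW.
  by apply: subset_leq_card; apply/subsetP => w /NPW.
have /card_gt1P[w1 [w2 [w1P w2P d12]]] : 1 < #|PS| by lia.
have /card_gt1P[w3 [w4 [w3P w4P d34]]] : 1 < #|NP| by lia.
have [j1 p1] := PSi w1 w1P; have [j2 p2] := PSi w2 w2P.
have W1 := PSW _ w1P; have W2 := PSW _ w2P; have W3 := NPW _ w3P; have W4' := NPW _ w4P.
have [w1A w1a _ _] := inW _ W1; have [w2A w2a _ _] := inW _ W2.
have [w3A w3a _ _] := inW _ W3; have [w4A w4a _ _] := inW _ W4'.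
have e12 := PP _ _ _ _ W1 W2 p1 p2 d12.
have dPN w w' : w \in PS -> w' \in NP -> w != w'.
  by move=> wP; apply: contraTneq => <-; move: wP; rewrite inE => /andP[].
(* [PS] and [NP] have two vertices each, and the edges between them will turn out to be a perfect
   matching. Then [a j2], [y j2], w1 and u' are stable, because [y j2], w2 and u' cannot form a
   triangle off [Aa]. *)
have fin u u' : u \in NP -> u' \in NP -> e w1 u -> e w2 u' -> ~~ e w1 u' -> False.
  move=> uN uN' _ e2 n1; have uW := NPW _ uN'; have [uA ua _ _] := inW _ uW.
  have j12 : j2 != j1.
    by apply: contraNneq d12 => E; rewrite E in p2; rewrite (P1 w1 w2 j1).
  apply: (stable4 al3 (in4 _ _ _ _ (aA j2) (yA j2) w1A uA)).
  rewrite {1}/co_edge ay nay (indaw w1) ?(privA w1 j1) // (indaw u') ?NPa //=.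
  rewrite (indyw w1) ?(privN w1 j1) // (indyw u') //=.
    by rewrite /co_edge dPN.
  apply/negP => euy; have := tri0 (y j2) w2 u' (yA j2) w2A uA (yAa j2) w2a ua.
  by rewrite edge_sym privY // edge_sym euy e2 => /(_ isT isT).
have n34 := NP2 _ _ w3P w4P.
have two w j l : w \in PS -> priv w j -> l != j -> e w w3 || e w w4.
  move=> wP pw lj; apply/negPn/negP; rewrite negb_or => /andP[n3 n4].
  have wW := PSW _ wP; have [wA _ _ _] := inW _ wW.
  apply: (stable4 al3 (in4 _ _ _ _ (aA l) wA w3A w4A)).
  by rewrite (indaw w) ?(privA w j) // (indaw w3) ?NPa // (indaw w4) ?NPa //
    /co_edge (dPN w w3) // (dPN w w4) // n3 n4 d34 n34.
have [l1 /andP[l1j _]] := ord3_third j1 j1; have [l2 /andP[l2j _]] := ord3_third j2 j2.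
have h1 := two _ _ _ w1P p1 l1j; have h2 := two _ _ _ w2P p2 l2j.
have t3 : e w1 w3 -> ~~ e w2 w3 by apply: tri0.
have t4 : e w1 w4 -> ~~ e w2 w4 by apply: tri0.
case/orP: h1 => [e13|e14].
  have n23 := t3 e13; rewrite (negPf n23) /= in h2.
  by apply: (fin w3 w4) => //; apply: contraTN h2.
have n24 := t4 e14; rewrite (negPf n24) orbF in h2.
by apply: (fin w4 w3) => //; apply: contraTN h2.
Qed.

(** R(3, 4) <= 9 gives a triangle avoiding any prescribed vertex. If all triangles met, two of them
    would share an edge ab, and triangles avoiding a and b respectively would produce a 3-sun. *)
Lemma two_disjoint_triangles A : #|A| = 10 -> al A <= 3 -> clique_free 4 A ->
  ~ meeting_triangles A.
Proof.
move=> A10 al3 cf mt.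
have avoid v : v \in A -> exists K, [/\ is_clique K, K \subset A, #|K| = 3 & v \notin K].
  move=> vA; have [cf3|[K [cK KA K3]]] := clique_free_dec 3 (A :\ v).
    have := ramsey49 cf3; have := cardsD1 v A; have := alpha_D A [set v].
    by rewrite vA A10; lia.
  exists K; split=> //; first exact: subset_trans KA (subsetDl _ _).
  by apply/negP => /(subsetP KA); rewrite setD11.
have in4 x u v w : x \in A -> u \in A -> v \in A -> w \in A ->
    {subset [:: x; u; v; w] <= A}.
  by move=> xA uA vA wA t; rewrite !inE => /or4P[]/eqP->.
have [a [b [c [d [[aA bA cA dA] ncd [eab eac ebc] [ead ebd]]]]]] : exists a b c d,
    [/\ [/\ a \in A, b \in A, c \in A & d \in A], c != d,
        [/\ e a b, e a c & e b c] & e a d /\ e b d].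
  have [//|NS] := boolP [exists a in A, exists b in A, exists c in A, exists d in A,
     [&& c != d, e a b, e a c, e b c, e a d & e b d]].
    case/exists_inP=> a aA /exists_inP[b bA /exists_inP[c cA /exists_inP[d dA]]].
    case/and5P=> cd ab ac bc /andP[ad bd]; by exists a, b, c, d.
  exfalso; have sh a b c d : a \in A -> b \in A -> c \in A -> d \in A ->
      e a b -> e a c -> e b c -> e a d -> e b d -> c = d.
    move=> aA bA cA dA ab ac bc ad bd; apply/eqP/negPn/negP => cd; case/negP: NS.
    apply/exists_inP; exists a => //; apply/exists_inP; exists b => //.
    apply/exists_inP; exists c => //; apply/exists_inP; exists d => //.
    by rewrite cd ab ac bc ad bd.
  (* Suppose every edge lies in at most one triangle. Then K0, K1, K2 meet pairwise in distinct
     vertices b, p, q, which form a second triangle on the edge pb of K0. *)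
  have [v vA] : exists v, v \in A by apply/card_gt0P; rewrite A10.
  have [K0 [cK0 K0A K03 _]] := avoid v vA.
  have [a aK0] : exists a, a \in K0 by apply/card_gt0P; rewrite K03.
  have aA := subsetP K0A _ aK0.
  have [K1 [cK1 K1A K13 aK1]] := avoid a aA.
  have [b /setIP[bK0 bK1]] := mt _ _ cK0 cK1 K0A K1A K03 K13.
  have bA := subsetP K0A _ bK0.
  have one q : q \in K0 -> q \in K1 -> q = b.
    move=> qK0 qK1; apply/eqP/negPn/negP => qb.
    have [d [dK1 db dq]] := third b q K13.
    have [qA dA] : q \in A /\ d \in A by rewrite (subsetP K0A) ?(subsetP K1A).
    case/negP: (aK1); rewrite (sh q b a d) //.
    - exact: (cliqueP _ cK1).
    - by apply: (cliqueP _ cK0) => //; apply: contraNneq aK1 => <-.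
    - by apply: (cliqueP _ cK0) => //; apply: contraNneq aK1 => <-.
    - by apply: (cliqueP _ cK1) => //; rewrite eq_sym.
    - by apply: (cliqueP _ cK1) => //; rewrite eq_sym.
  have [K2 [cK2 K2A K23 bK2]] := avoid b bA.
  have [p /setIP[pK0 pK2]] := mt _ _ cK0 cK2 K0A K2A K03 K23.
  have [q /setIP[qK1 qK2]] := mt _ _ cK1 cK2 K1A K2A K13 K23.
  have pb : p != b by apply: contraNneq bK2 => <-.
  have qb : q != b by apply: contraNneq bK2 => <-.
  have pq : p != q.
    by apply: contraNneq pb => E; apply/eqP/one; rewrite // E.
  have [r [rK0 rp rb]] := third p b K03.
  have [pA rA qA] : [/\ p \in A, r \in A & q \in A].
    by split; [apply: (subsetP K0A)|apply: (subsetP K0A)|apply: (subsetP K1A)].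
  case/eqP: qb; apply: one => //; rewrite -(sh p b r q) //.
  - exact: (cliqueP _ cK0).
  - by apply: (cliqueP _ cK0) => //; rewrite eq_sym.
  - by apply: (cliqueP _ cK0) => //; rewrite eq_sym.
  - exact: (cliqueP _ cK2).
  - apply: (cliqueP _ cK1) => //; apply: contraNneq bK2 => ->; exact: qK2.
have meetsE K u v c0 : is_clique K -> K \subset A -> #|K| = 3 -> u \in A -> v \in A ->
    c0 \in A -> e u v -> e u c0 -> e v c0 -> u \notin K -> v \notin K -> c0 \in K.
  move=> cK KA K3 uA vA c0A uv uc vc uK vK.
  have [cL L3] := triangle_set uv uc vc.
  have [|t] := mt _ _ cK cL KA _ K3 L3.
    by apply/subsetP => t; rewrite !inE => /orP[/orP[]|] /eqP->.
  rewrite !inE => /andP[tK /orP[/orP[]|] /eqP tE]; rewrite tE in tK => //.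
    by rewrite tK in uK.
  by rewrite tK in vK.
(* A triangle avoiding both ends of uv would have to contain c and d, making u, v, c, d a clique. *)
have other K u v : is_clique K -> K \subset A -> #|K| = 3 -> u \in A -> v \in A ->
    e u v -> e u c -> e v c -> e u d -> e v d -> u \notin K -> v \in K.
  move=> cK KA K3 uA vA uv uc vc ud vd uK; apply/negPn/negP => vK.
  have cK' := meetsE K u v c cK KA K3 uA vA cA uv uc vc uK vK.
  have dK' := meetsE K u v d cK KA K3 uA vA dA uv ud vd uK vK.
  apply: (clique4 cf (in4 _ _ _ _ uA vA cA dA)).
  by rewrite uv uc vc ud vd (cliqueP _ cK).
(* K avoids a and contains b, L the reverse. With x common to both, abx is the inner triangle of the
   sun; its tips are y, z and f, where f is c or d. *)
have [K [cK KA K3 aK]] := avoid a aA.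
have bK := other K a b cK KA K3 aA bA eab eac ebc ead ebd aK.
have [L [cL LA L3 bL]] := avoid b bA.
have eba : e b a by rewrite edge_sym.
have aL := other L b a cL LA L3 bA aA eba ebc eac ebd ead bL.
have [x /setIP[xK xL]] := mt _ _ cK cL KA LA K3 L3.
have xA := subsetP KA _ xK.
have xa : x != a by apply: contraNneq aK => <-.
have xb : x != b by apply: contraNneq bL => <-.
have eax : e a x by apply: (cliqueP _ cL) => //; rewrite eq_sym.
have ebx : e b x by apply: (cliqueP _ cK) => //; rewrite eq_sym.
have [y [yK yb yx]] := third b x K3; have yA := subsetP KA _ yK.
have [z [zL za zx]] := third a x L3; have zA := subsetP LA _ zL.
have ya : y != a by apply: contraNneq aK => <-.
have zb : z != b by apply: contraNneq bL => <-.
have eby : e b y by apply: (cliqueP _ cK) => //; rewrite eq_sym.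
have exy : e x y by apply: (cliqueP _ cK) => //; rewrite eq_sym.
have eaz : e a z by apply: (cliqueP _ cL) => //; rewrite eq_sym.
have exz : e x z by apply: (cliqueP _ cL) => //; rewrite eq_sym.
have [f [fA fx eaf ebf]] : exists f, [/\ f \in A, f != x, e a f & e b f].
  by have [E|ne] := eqVneq c x; [exists d; rewrite -E eq_sym | exists c].
have nay : ~~ e a y.
  by apply/negP => eay; apply: (clique4 cf (in4 _ _ _ _ aA bA xA yA));
    rewrite eab eax eay ebx eby exy.
have nbz : ~~ e b z.
  by apply/negP => ebz; apply: (clique4 cf (in4 _ _ _ _ aA bA xA zA));
    rewrite eab eax eaz ebx ebz exz.
have nxf : ~~ e x f.
  by apply/negP => exf; apply: (clique4 cf (in4 _ _ _ _ aA bA xA fA));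
    rewrite eab eax eaf ebx ebf exf.
have fa : f != a by rewrite eq_sym (edge_neq eaf).
have fb : f != b by rewrite eq_sym (edge_neq ebf).
have yz : y != z by apply: contraNneq nay => ->.
have fy : f != y by apply: contraNneq nxf => ->.
have fz : f != z by apply: contraNneq nxf => ->.
have in6 u0 u1 u2 u3 u4 u5 : [/\ u0 \in A, u1 \in A & u2 \in A] ->
   [/\ u3 \in A, u4 \in A & u5 \in A] -> {subset [:: u0; u1; u2; u3; u4; u5] <= A}.
  move=> [? ? ?] [? ? ?] t; rewrite !inE; do 5 (case/orP=> [/eqP-> //|]); by move/eqP->.
have nfz : ~~ e f z.
  apply/negP => efz; have := @meeting_seq A a f z b x y mt
    (in6 _ _ _ _ _ _ (And3 aA fA zA) (And3 bA xA yA)) eaf eaz efz ebx eby exy.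
  rewrite /= !inE (negPf (edge_neq eab)) (negPf (edge_neq eax)) [a == y]eq_sym (negPf ya).
  by rewrite (negPf fb) (negPf fx) (negPf fy) (negPf zb) (negPf zx) [z == y]eq_sym (negPf yz).
have nfy : ~~ e f y.
  apply/negP => efy; have := @meeting_seq A b f y a x z mt
    (in6 _ _ _ _ _ _ (And3 bA fA yA) (And3 aA xA zA)) ebf eby efy eax eaz exz.
  rewrite /= !inE (negPf (edge_neq eba)) (negPf (edge_neq ebx)) [b == z]eq_sym (negPf zb).
  by rewrite (negPf fa) (negPf fx) (negPf fz) (negPf ya) (negPf yx) (negPf yz).
have nyz : ~~ e y z.
  apply/negP => eyz; have := @meeting_seq A x y z a b f mt
    (in6 _ _ _ _ _ _ (And3 xA yA zA) (And3 aA bA fA)) exy exz eyz eab eaf ebf.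
  rewrite /= !inE (negPf xa) (negPf xb) [x == f]eq_sym (negPf fx).
  by rewrite (negPf ya) (negPf yb) [y == f]eq_sym (negPf fy) (negPf za) (negPf zb)
    [z == f]eq_sym (negPf fz).
pose af (i : 'I_3) := nth a [:: a; b; x] i.
pose yf (i : 'I_3) := nth y [:: y; z; f] i.
have S := @edge_sym G.
apply: (@no_sun A af yf) => //.
- by case=> [[|[|[|//]]]] ?.
- by case=> [[|[|[|//]]]] ?.
- move=> [[|[|[|//]]] ?] [[|[|[|//]]] ?] E; apply/val_inj => //=; move/eqP: E;
  rewrite /yf /=.
  + by rewrite (negPf yz).
  + by rewrite eq_sym (negPf fy).
  + by rewrite eq_sym (negPf yz).
  + by rewrite eq_sym (negPf fz).
  + by rewrite (negPf fy).
  + by rewrite (negPf fz).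
- by move=> [[|[|[|//]]] ?] [[|[|[|//]]] ?] //= _; rewrite /af /= // S.
- by move=> [[|[|[|//]]] ?] [[|[|[|//]]] ?] //= _; rewrite /af /yf /= // S.
- by move=> [[|[|[|//]]] ?]; rewrite /af /yf /=.
- move=> [[|[|[|//]]] ?] [[|[|[|//]]] ?]; rewrite /yf /= ?edge_irr //; by rewrite S.
Qed.

End TenAlphaThree.

(** * Two disjoint triangles and four further vertices *)

Section Leftover.

Variable G : sgraph.
Implicit Types (A B K L S U C D P Q W : {set G}) (x y z k p q v w : G).

Notation e := (@edge G).
Notation ind := (@co_edge G).

(** After two disjoint triangles are set aside, an edge pq and vertices v, y remain, with q, v, y
    stable. Only the adjacencies of p to v and y are open, and [leftover_false] closes each
    possibility. *)
Record leftover A L L' p q v y : Prop := Leftover {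
  lo_clique : is_clique L;
  lo_clique' : is_clique L';
  lo_card : #|L| = 3;
  lo_card' : #|L'| = 3;
  lo_sub : {subset L <= A};
  lo_sub' : {subset L' <= A};
  lo_in : {subset [:: p; q; v; y] <= A};
  lo_cover : {in A, forall x, [|| x \in L, x \in L' | x \in [:: p; q; v; y]]};
  lo_disjoint : {in L & L', forall x z, x != z};
  lo_out : {in L, forall x, x \notin [:: p; q; v; y]};
  lo_out' : {in L', forall x, x \notin [:: p; q; v; y]};
  lo_uniq : uniq [:: p; q; v; y];
  lo_pq : e p q;
  lo_qv : ~~ e q v;
  lo_qy : ~~ e q y;
  lo_vy : ~~ e v y }.

Lemma leftover_swap A L L' p q v y :
  leftover A L L' p q v y -> leftover A L' L p q v y.
Proof.
case=> cL cL' L3 L3' LA LA' QA cov dL oL oL' u pq qv qy vy; split=> //.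
  by move=> x /cov; rewrite orbCA.
by move=> x z xL zL; rewrite eq_sym; apply: dL.
Qed.

Lemma leftover_perm A L L' p q v y p' q' v' y' :
  perm_eq [:: p; q; v; y] [:: p'; q'; v'; y'] ->
  e p' q' -> ~~ e q' v' -> ~~ e q' y' -> ~~ e v' y' ->
  leftover A L L' p q v y -> leftover A L L' p' q' v' y'.
Proof.
move=> pe pq' qv' qy' vy' [cL cL' L3 L3' LA LA' QA cov dL oL oL' u pq qv qy vy].
have E := perm_mem pe; split=> //.
- by move=> x; rewrite -E; apply: QA.
- by move=> x /cov; rewrite E.
- by move=> x /oL; rewrite E.
- by move=> x /oL'; rewrite E.
- by rewrite -(perm_uniq pe).
Qed.

Lemma theta_clique_seqs A K (ss : seq (seq G)) :
  is_clique K -> {subset A <= [predU K & flatten ss]} -> all (pairwise e) ss ->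
  {in K, forall k, exists2 s, s \in ss & all (e k) s} -> th A <= size ss.
Proof.
move=> cK sA ass H; pose Qs := [seq [set x in s] | s <- ss].
have -> : size ss = size Qs by rewrite size_map.
have aQ : all (@is_clique G) Qs.
  by apply/allP => Q /mapP[s sss ->]; apply: clique_seq; apply: (allP ass).
have := @clique_absorb _ Qs K aQ cK.
move=> H'; have {H'} : th (K :|: \bigcup_(Q <- Qs) Q) <= size Qs.
  apply: H' => k kK; have [s sss ks] := H k kK.
  exists [set x in s]; first by apply/mapP; exists s.
  by move=> x; rewrite inE => xs; apply: (allP ks).
apply: leq_trans; apply: thetaS; apply/subsetP => x /sA.
rewrite !inE => /orP[->//|/flattenP[s sss xs]]; apply/orP; right.
rewrite big_map; elim: ss sss {sA ass H Qs aQ} => [//|s' ss IH].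
rewrite big_cons !inE => /orP[/eqP<-|/IH->]; last by rewrite orbT.
by rewrite xs.
Qed.

Variable A : {set G}.
Hypotheses (al3 : al A <= 3) (th4 : 4 < th A) (cf : clique_free 4 A).

Let S4 x y z w : x \in A -> y \in A -> z \in A -> w \in A ->
  ~ [&& ind x y, ind x z, ind x w, ind y z, ind y w & ind z w].
Proof.
move=> xA yA zA wA; apply: stable4 al3 _ => t.
by rewrite !inE => /or4P[]/eqP->.
Qed.

Let K4 x y z w : x \in A -> y \in A -> z \in A -> w \in A ->
  ~ [&& e x y, e x z, e x w, e y z, e y w & e z w].
Proof.
move=> xA yA zA wA; apply: clique4 cf _ => t.
by rewrite !inE => /or4P[]/eqP->.
Qed.

Section Configuration.

Variables (L L' : {set G}) (p q v y : G).
Hypothesis lo : leftover A L L' p q v y.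

Lemma leftover_mem : [/\ p \in A, q \in A, v \in A & y \in A].
Proof. by split; apply: (lo_in lo); rewrite !inE eqxx ?orbT. Qed.

Lemma leftover_neq : [/\ [/\ p != q, p != v & p != y], q != v, q != y & v != y].
Proof.
have := lo_uniq lo; rewrite /= !inE !negb_or => /and4P[/and3P[-> -> ->] /andP[-> ->] ->].
by [].
Qed.

Lemma leftover_neqL t : t \in L -> [/\ t != p, t != q, t != v & t != y].
Proof. by move/(lo_out lo); rewrite !inE !negb_or => /and4P[]. Qed.

Lemma leftover_nbr t : t \in L -> [|| e t q, e t v | e t y].
Proof.
move=> tL; have [_ tq tv ty] := leftover_neqL tL.
have [_ qA vA yA] := leftover_mem; have [_ qv qy vy] := leftover_neq.
apply/negPn/negP; rewrite !negb_or => /and3P[nq nv ny].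
apply: (S4 (lo_sub lo tL) qA vA yA).
by rewrite /co_edge tq tv ty qv qy vy nq nv ny (lo_qv lo) (lo_qy lo) (lo_vy lo).
Qed.

(** L' is a single clique, so the rest needs four; three cliques covering the four vertices can
    therefore not absorb L. *)
Lemma leftover_cover (ss : seq (seq G)) :
  all (pairwise e) ss -> size ss <= 3 -> {subset [:: p; q; v; y] <= flatten ss} ->
  ~ {in L, forall k, (k \in flatten ss) || has (all (e k)) ss}.
Proof.
move=> ass s3 sQ H; have := theta_D_clique A (lo_clique' lo).
suff : th (A :\: L') <= 3 by move: th4; lia.
apply: leq_trans s3.
apply: (@theta_clique_seqs _ (L :\: [set x in flatten ss])) => //.
- by apply: cliqueS (lo_clique lo); apply: subsetDl.
- move=> x; rewrite inE => /andP[xL' /(lo_cover lo)]; rewrite (negPf xL') /=.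
  case/orP=> [xL|/sQ xs]; last by rewrite !inE [x \in flatten _]xs orbT.
  by rewrite !inE xL andbT orNb.
move=> k; rewrite !inE => /andP[ks kL]; have := H k kL.
by rewrite (negPf ks) /= => /hasP[s sss ks']; exists s.
Qed.

(* Otherwise [L] and the four leftover vertices are covered by three cliques. *)
Lemma leftover_private : exists2 t, t \in L & [&& e t q, ~~ e t v & ~~ e t y].
Proof.
case: (boolP [exists t in L, [&& e t q, ~~ e t v & ~~ e t y]]) => [/exists_inP//|].
move=> /exists_inPn H; exfalso.
apply: (@leftover_cover [:: [:: p; q]; [:: v]; [:: y]]) => //=.
- by rewrite (lo_pq lo).
- by move=> k kL; have := H k kL; have := leftover_nbr kL; rewrite /=;
    case: (e k q); case: (e k v); case: (e k y); rewrite /= ?orbT.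
Qed.

Lemma leftover_private' t : t \in L -> [&& ~~ e t v & ~~ e t y] -> ~~ e p v ->
  ~~ e p y -> e t p.
Proof.
move=> tL /andP[nv ny] npv npy; apply/negPn/negP => np.
have [tp tq tv ty] := leftover_neqL tL.
have [pA qA vA yA] := leftover_mem; have [[_ pv py] qv qy vy] := leftover_neq.
apply: (S4 (lo_sub lo tL) pA vA yA).
by rewrite /co_edge tp tv ty pv py vy np nv ny npv npy (lo_vy lo).
Qed.

(** A vertex t of L private to q also sees p, so {t, p, q}, {v}, {y} are cliques. Another vertex of
    L seeing neither v nor y would form a clique of size four with t, p, q; all others are
    absorbed. *)
Lemma leftover_isolated_edge : ~~ e p v -> ~~ e p y -> False.
Proof.
move=> npv npy; have [t tL /and3P[tq nv ny]] := leftover_private.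
have [pA qA vA yA] := leftover_mem; have pq := lo_pq lo.
have tp : e t p by apply: leftover_private'; rewrite // nv ny.
apply: (@leftover_cover [:: [:: t; p; q]; [:: v]; [:: y]]) => //=.
- by rewrite tp tq pq.
- by move=> x; rewrite !inE => /or4P[]->; rewrite ?orbT.
move=> k kL; have [-> //|kt] := eqVneq k t; first by rewrite inE eqxx.
case kv: (e k v); first by rewrite /= !orbT.
case ky: (e k y); first by rewrite /= !orbT.
have kq : e k q by have := leftover_nbr kL; rewrite kv ky !orbF.
have kp : e k p by apply: leftover_private'; rewrite // kv ky.
case: (K4 (lo_sub lo kL) (lo_sub lo tL) pA qA).
by rewrite kp kq tp tq pq (cliqueP _ (lo_clique lo)).
Qed.

End Configuration.

(** q, v and y play the same role, so each has a private neighbour in both triangles. The two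
    belonging to one vertex are adjacent, or they would be stable together with the other two of q,
    v, y. Three triangles and {p} then cover A. *)
Lemma leftover_star L L' p q v y : leftover A L L' p q v y -> e p v -> e p y -> False.
Proof.
move=> lo pv py.
have qv := lo_qv lo; have qy := lo_qy lo; have vy := lo_vy lo.
have vq : ~~ e v q by rewrite edge_sym.
have yq : ~~ e y q by rewrite edge_sym.
have yv : ~~ e y v by rewrite edge_sym.
have priv M M' : leftover A M M' p q v y ->
    exists tq tv ty, [/\ [/\ tq \in M, tv \in M & ty \in M],
      [&& e tq q, ~~ e tq v & ~~ e tq y], [&& e tv v, ~~ e tv q & ~~ e tv y] &
      [&& e ty y, ~~ e ty q & ~~ e ty v]].
  move=> loM.
  have lov : leftover A M M' p v q y.
    apply: leftover_perm loM => //; rewrite perm_cons.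
    exact/permPl/(perm_catCA [:: q] [:: v] [:: y]).
  have loy : leftover A M M' p y q v.
    apply: leftover_perm loM => //; rewrite perm_cons.
    exact/permPl/(perm_catC [:: q; v] [:: y]).
  have [tq tqM Hq] := leftover_private loM.
  have [tv tvM Hv] := leftover_private lov.
  have [ty tyM Hy] := leftover_private loy.
  by exists tq, tv, ty.
have lo' := leftover_swap lo.
have [tq [tv [ty [[qL vL yL] /and3P[qq q1 q2] /and3P[vv v1 v2] /and3P[yy y1 y2]]]]] := priv _ _ lo.
have [uq [uv [uy [[qL' vL' yL'] /and3P[qq' q1' q2'] /and3P[vv' v1' v2'] /and3P[yy' y1' y2']]]]] :=
  priv _ _ lo'.
have [pA qA vA yA] := leftover_mem lo; have [_ dqv dqy dvy] := leftover_neq lo.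
have join t u a b : t \in L -> u \in L' -> a \in A -> b \in A -> a != b -> ~~ e a b ->
    t != a -> t != b -> u != a -> u != b ->
    ~~ e t a -> ~~ e t b -> ~~ e u a -> ~~ e u b -> e t u.
  move=> tL uL aA bA ab nab ta tb ua ub nta ntb nua nub; apply/negPn/negP => ntu.
  apply: (S4 (lo_sub lo tL) (lo_sub' lo uL) aA bA).
  by rewrite /co_edge ta tb ua ub ab nab nta ntb nua nub ntu (lo_disjoint lo).
have [tqp tqq tqv tqy] := leftover_neqL lo qL.
have [tvp tvq tvv tvy] := leftover_neqL lo vL.
have [typ tyq tyv tyy] := leftover_neqL lo yL.
have [uqp uqq uqv uqy] := leftover_neqL lo' qL'.
have [uvp uvq uvv uvy] := leftover_neqL lo' vL'.
have [uyp uyq uyv uyy] := leftover_neqL lo' yL'.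
have eq_ : e tq uq by apply: (join _ _ v y).
have ev_ : e tv uv by apply: (join _ _ q y).
have ey_ : e ty uy by apply: (join _ _ q v).
have dif a t u : e t a -> ~~ e u a -> t != u by move=> ta; apply: contraNneq => <-.
have mem3 (M : {set G}) a b c : #|M| = 3 -> a \in M -> b \in M -> c \in M ->
    a != b -> a != c -> b != c -> {subset M <= [:: a; b; c]}.
  move=> M3 aM bM cM ab ac bc.
  have us : uniq [:: a; b; c] by rewrite /= !inE negb_or ab ac bc.
  have E : [set x in [:: a; b; c]] = M.
    apply/eqP; rewrite eqEcard M3 cardsE (card_uniqP us) andbT.
    by apply/subsetP => x; rewrite !inE => /or3P[]/eqP->.
  by move=> x; rewrite -E inE.
have LE := mem3 L tq tv ty (lo_card lo) qL vL yL (dif q _ _ qq v1)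
  (dif q _ _ qq y1) (dif v _ _ vv y2).
have LE' := mem3 L' uq uv uy (lo_card' lo) qL' vL' yL' (dif q _ _ qq' v1')
  (dif q _ _ qq' y1') (dif v _ _ vv' y2').
have : th A <= size [:: [:: q; tq; uq]; [:: v; tv; uv]; [:: y; ty; uy]; [:: p]].
  apply: theta_seqs.
    move=> x /(lo_cover lo)/or3P[/LE|/LE'|]; rewrite /= !inE.
    - by case/or3P=> ->; rewrite ?orbT.
    - by case/or3P=> ->; rewrite ?orbT.
    - by case/or4P=> ->; rewrite ?orbT.
  by rewrite /= ![e _ tq]edge_sym ![e _ tv]edge_sym ![e _ ty]edge_sym
     ?(edge_sym q uq) ?(edge_sym v uv) ?(edge_sym y uy) qq vv yy qq' vv' yy'
     ?(edge_sym uq) ?(edge_sym uv) ?(edge_sym uy) eq_ ev_ ey_.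
by rewrite leqNgt th4.
Qed.

Hypothesis deg2 : {in A, forall x, 1 < #|nbr A x|}.

(** q and v have private neighbours [t1], [t2] in L and [u1], [u2] in L', so y can see only the
    third vertices [t3] and [u3], and sees both because its degree is at least two. Covers by four
    cliques show that p sees no private neighbour; absence of stable sets of size four then makes
    the private neighbours a clique of size four. *)
Lemma leftover_path L L' p q v y :
  leftover A L L' p q v y -> e p v -> ~~ e p y -> False.
Proof.
move=> lo pv npy.
have pq := lo_pq lo.
have qv := lo_qv lo; have qy := lo_qy lo; have vy := lo_vy lo.
have vq : ~~ e v q by rewrite edge_sym.
have yq : ~~ e y q by rewrite edge_sym.
have yv : ~~ e y v by rewrite edge_sym.
have priv M M' : leftover A M M' p q v y ->
    exists tq tv, [/\ tq \in M, tv \in M,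
      [&& e tq q, ~~ e tq v & ~~ e tq y] & [&& e tv v, ~~ e tv q & ~~ e tv y]].
  move=> loM.
  have lov : leftover A M M' p v q y.
    apply: leftover_perm loM => //; rewrite perm_cons.
    exact/permPl/(perm_catCA [:: q] [:: v] [:: y]).
  have [tq tqM Hq] := leftover_private loM.
  have [tv tvM Hv] := leftover_private lov.
  by exists tq, tv.
have lo' := leftover_swap lo.
have [t1 [t2 [qL vL /and3P[qq q1 q2] /and3P[vv v1 v2]]]] := priv _ _ lo.
have [u1 [u2 [qL' vL' /and3P[qq' q1' q2'] /and3P[vv' v1' v2']]]] := priv _ _ lo'.
have [pA qA vA yA] := leftover_mem lo; have [[dpq dpv dpy] dqv dqy dvy] := leftover_neq lo.
have d12 : t1 != t2 by apply: contraNneq v1 => <-.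
have d12' : u1 != u2 by apply: contraNneq v1' => <-.
have [t3 [yL d31 d32]] := third t1 t2 (lo_card lo).
have [u3 [yL' d31' d32']] := third u1 u2 (lo_card' lo).
have mem3 (M : {set G}) a b c : #|M| = 3 -> a \in M -> b \in M -> c \in M ->
    a != b -> c != a -> c != b -> {subset M <= [:: a; b; c]}.
  move=> M3 aM bM cM ab ac bc.
  have us : uniq [:: a; b; c] by rewrite /= !inE negb_or ab eq_sym ac eq_sym bc.
  have E : [set x in [:: a; b; c]] = M.
    apply/eqP; rewrite eqEcard M3 cardsE (card_uniqP us) andbT.
    by apply/subsetP => x; rewrite !inE => /or3P[]/eqP->.
  by move=> x; rewrite -E inE.
have LE := mem3 L t1 t2 t3 (lo_card lo) qL vL yL d12 d31 d32.
have LE' := mem3 L' u1 u2 u3 (lo_card' lo) qL' vL' yL' d12' d31' d32'.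
have [yt yu] : e y t3 /\ e y u3.
  have sN : nbr A y \subset [set t3; u3].
    apply/subsetP => x; rewrite !inE => /andP[/(lo_cover lo)/or3P[/LE|/LE'|]].
    - rewrite !inE => /or3P[/eqP->|/eqP->|->//]; rewrite edge_sym.
        by rewrite (negPf q2).
      by rewrite (negPf v2).
    - rewrite !inE => /or3P[/eqP->|/eqP->|->]; rewrite ?orbT // edge_sym.
        by rewrite (negPf q2').
      by rewrite (negPf v2').
    - rewrite !inE => /or4P[]/eqP->; rewrite ?edge_irr ?(negPf yq) ?(negPf yv) //.
      by rewrite edge_sym (negPf npy).
  have c2 := deg2 yA; have E : nbr A y = [set t3; u3].
    apply/eqP; rewrite eqEcard sN /=; apply: (@leq_trans 2 _ _ _ c2).
    by rewrite cards2; case: (t3 != u3).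
  have : t3 \in nbr A y by rewrite E !inE eqxx.
  have : u3 \in nbr A y by rewrite E !inE eqxx orbT.
  by rewrite !inE => /andP[_ ->] /andP[_ ->].
have no_cover ss : all (pairwise e) ss -> size ss <= 4 ->
    all [in flatten ss] [:: t1; t2; t3; u1; u2; u3; p; q; v; y] -> False.
  move=> ass s4 /allP H; have : th A <= size ss.
    apply: theta_seqs ass => x xA; apply: H.
    have /or3P[/LE|/LE'|] := lo_cover lo xA; rewrite !inE.
    - by case/or3P=> ->; rewrite ?orbT.
    - by case/or3P=> ->; rewrite ?orbT.
    - by case/or4P=> ->; rewrite ?orbT.
  by move=> le; have := leq_ltn_trans (leq_trans le s4) th4; rewrite ltnn.
have [t1p t1q t1v t1y] := leftover_neqL lo qL.
have [t2p t2q t2v t2y] := leftover_neqL lo vL.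
have [u1p u1q u1v u1y] := leftover_neqL lo' qL'.
have [u2p u2q u2v u2y] := leftover_neqL lo' vL'.
have LA := lo_sub lo; have LA' := lo_sub' lo; have dL := lo_disjoint lo.
have e11 : e t1 u1.
  apply/negPn/negP => n; apply: (S4 (LA _ qL) (LA' _ qL') vA yA).
  by rewrite /co_edge dL // n t1v q1 t1y q2 u1v q1' u1y q2' dvy vy.
have e22 : e t2 u2.
  apply/negPn/negP => n; apply: (S4 (LA _ vL) (LA' _ vL') qA yA).
  by rewrite /co_edge dL // n t2q v1 t2y v2 u2q v1' u2y v2' dqy qy.
have cL a b : a \in L -> b \in L -> a != b -> e a b by apply: (cliqueP _ (lo_clique lo)).
have cL' a b : a \in L' -> b \in L' -> a != b -> e a b.
  by apply: (cliqueP _ (lo_clique' lo)).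
have S := @edge_sym G.
have np1 : ~~ e p t1.
  apply/negP => h.
  apply: (no_cover [:: [:: p; q; t1]; [:: v; t2; u2]; [:: y; t3]; [:: u1; u3]]) => //=.
    by rewrite pq h (S q) qq (S v t2) vv (S v u2) vv' e22 yt cL' // eq_sym.
  by rewrite !inE !eqxx !orbT.
have np2 : ~~ e p t2.
  apply/negP => h.
  apply: (no_cover [:: [:: p; v; t2]; [:: q; t1; u1]; [:: y; t3]; [:: u2; u3]]) => //=.
    by rewrite pv h (S v) vv (S q t1) qq (S q u1) qq' e11 yt cL' // eq_sym.
  by rewrite !inE !eqxx !orbT.
have np1' : ~~ e p u1.
  apply/negP => h.
  apply: (no_cover [:: [:: p; q; u1]; [:: v; t2; u2]; [:: y; u3]; [:: t1; t3]]) => //=.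
    by rewrite pq h (S q) qq' (S v t2) vv (S v u2) vv' e22 yu cL // eq_sym.
  by rewrite !inE !eqxx !orbT.
have np2' : ~~ e p u2.
  apply/negP => h.
  apply: (no_cover [:: [:: p; v; u2]; [:: q; t1; u1]; [:: y; u3]; [:: t2; t3]]) => //=.
    by rewrite pv h (S v) vv' (S q t1) qq (S q u1) qq' e11 yu cL // eq_sym.
  by rewrite !inE !eqxx !orbT.
have e12 : e t1 u2.
  apply/negPn/negP => n; apply: (S4 (LA _ qL) (LA' _ vL') pA yA).
  by rewrite /co_edge dL // n t1p (S t1) np1 t1y q2 u2p (S u2) np2' u2y v2' dpy npy.
have e21 : e t2 u1.
  apply/negPn/negP => n; apply: (S4 (LA _ vL) (LA' _ qL') pA yA).
  by rewrite /co_edge dL // n t2p (S t2) np2 t2y v2 u1p (S u1) np1' u1y q2' dpy npy.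
apply: (K4 (LA _ qL) (LA _ vL) (LA' _ qL') (LA' _ vL')).
by rewrite cL // e11 e12 e21 e22 cL'.
Qed.

Lemma leftover_false L L' p q v y : leftover A L L' p q v y -> False.
Proof.
move=> lo; have pq := lo_pq lo; have vy := lo_vy lo; have qv := lo_qv lo; have qy := lo_qy lo.
have [pv|npv] := boolP (e p v); have [py|npy] := boolP (e p y).
- exact: leftover_star lo pv py.
- exact: leftover_path lo pv npy.
- have lo2 : leftover A L L' p q y v.
    apply: leftover_perm lo => //; first by rewrite !perm_cons;
      apply/permPl/(perm_catC [:: v] [:: y]).
    by rewrite edge_sym.
  exact: leftover_path lo2 py npv.
- exact: leftover_isolated_edge lo npv npy.
Qed.

End Leftover.

(** * Gap of graphs with at most sixteen vertices *)

Section UpToSixteen.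

Variable G : sgraph.
Implicit Types (A B K L S T U V C D P Q W : {set G}) (x y z k p q v w : G).

Notation e := (@edge G).

Lemma disjoint_triangles A : ~ meeting_triangles A -> exists K L : {set G},
  [/\ is_clique K, is_clique L, K \subset A /\ L \subset A, #|K| = 3 /\ #|L| = 3 &
      K :&: L = set0].
Proof.
move=> nm; case: (boolP [exists K : {set G}, [exists L : {set G},
   [&& is_clique K && is_clique L, (K \subset A) && (L \subset A),
       (#|K| == 3) && (#|L| == 3) & K :&: L == set0]]]).
  case/existsP=> K /existsP[L /and4P[/andP[cK cL] /andP[KA LA] /andP[/eqP K3 /eqP L3] /eqP KL]].
  by exists K, L.
move=> /existsPn H; case: nm => K L cK cL KA LA K3 L3.
apply/set0Pn; have /existsPn/(_ L) := H K.
by rewrite cK cL KA LA K3 L3.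
Qed.

(** Deleting two disjoint triangles leaves four vertices with theta at least 3. They consist of an
    edge xy and non-adjacent u, v, and as two cliques do not cover them, one end of xy sees neither
    u nor v: a [leftover]. *)
Lemma excess1_alpha3 A : minset (excess 1) A -> #|A| = 10 -> clique_free 4 A ->
  al A <= 3 -> 4 < th A -> False.
Proof.
move=> mA A10 cf al3 th4.
have [K [L [cK cL [KA LA] [K3 L3] KL]]] :=
  disjoint_triangles (two_disjoint_triangles A10 al3 cf).
pose Q := (A :\: K) :\: L.
have LAK : L \subset A :\: K.
  by rewrite subsetD LA -setI_eq0 setIC KL eqxx.
have Q4 : #|Q| = 4 by rewrite !cardsDS // A10 K3 L3.
have QA : Q \subset A by rewrite /Q setDDl subsetDl.
have thQ : 2 < th Q.
  by have := theta_D_clique A cK; have := theta_D_clique (A :\: K) cL; rewrite -/Q; lia.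
have : ~~ is_stable Q.
  by apply/negP => sQ; have := alpha_ge sQ QA; rewrite Q4; lia.
case/forall_inPn=> x xQ /forall_inPn[y yQ]; rewrite negbK => exy.
have nxy := edge_neq exy.
have c2 : #|Q :\: [set x; y]| == 2.
  rewrite cardsDS ?cards2 ?nxy ?Q4 //.
  by apply/subsetP => z /set2P[]->.
have [u [v [nuv defuv]]] := cards2P _ c2.
have uvQ z : z \in [set u; v] -> [/\ z \in Q, z != x & z != y].
  by rewrite -defuv in_setD in_set2 negb_or => /andP[/andP[-> ->] ->].
have [uQ ux uy] := uvQ u (set21 _ _); have [vQ vx vy] := uvQ v (set22 _ _).
have mQ z : (z \in Q) = (z \in [:: x; y; u; v]).
  apply/idP/idP => [zQ|]; last by rewrite in_cons in_cons in_cons mem_seq1 => /or4P[]/eqP->.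
  have /setP/(_ z) := defuv; rewrite in_setD zQ andbT !in_set2 !inE.
  by case: (z == x); case: (z == y) => //= <-.
have th2 ss : all (pairwise e) ss -> size ss <= 2 ->
    all [in flatten ss] [:: x; y; u; v] -> False.
  move=> ass s2 /allP H; have : th Q <= size ss.
    by apply: theta_seqs ass => z; rewrite mQ; apply: H.
  by move=> le; have := leq_ltn_trans (leq_trans le s2) thQ; rewrite ltnn.
have uvn : ~~ e u v.
  apply/negP => h; apply: (th2 [:: [:: x; y]; [:: u; v]]) => //=.
    by rewrite exy h.
  by rewrite !inE !eqxx !orbT.
have tri z z' : z \in [:: u; v] -> z' \in [:: u; v] -> z != z' -> e x z -> ~~ e y z.
  move=> zin zin' zz exz; apply/negP => eyz.
  apply: (th2 [:: [:: x; y; z]; [:: z']]) => //=; first by rewrite exy exz eyz.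
  move: zin zin' zz; rewrite !inE => /orP[]/eqP-> /orP[]/eqP->; rewrite ?eqxx //= => _;
  by rewrite ?inE ?eqxx ?orbT.
have mat z z' : z \in [:: u; v] -> z' \in [:: u; v] -> z != z' -> e x z -> ~~ e y z'.
  move=> zin zin' zz exz; apply/negP => eyz.
  apply: (th2 [:: [:: x; z]; [:: y; z']]) => //=; first by rewrite exz eyz.
  move: zin zin' zz; rewrite !inE => /orP[]/eqP-> /orP[]/eqP->; rewrite ?eqxx //= => _;
  by rewrite ?inE ?eqxx ?orbT.
have [uin vin] : u \in [:: u; v] /\ v \in [:: u; v] by rewrite !inE !eqxx orbT.
have nvu : v != u by rewrite eq_sym.
have mk p q : perm_eq [:: p; q; u; v] [:: x; y; u; v] -> e p q -> ~~ e q u ->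
    ~~ e q v -> leftover A K L p q u v.
  move=> pe pq qu qv; have E z : (z \in [:: p; q; u; v]) = (z \in Q).
    by rewrite (perm_mem pe) mQ.
  split=> //.
  - exact: (subsetP KA).
  - exact: (subsetP LA).
  - by move=> z; rewrite E; apply: (subsetP QA).
  - by move=> z zA; rewrite E !in_setD zA; case: (z \in K); case: (z \in L).
  - move=> a b aK bL; apply: contraTneq bL => <-; apply/negP => aL.
    by have /setP/(_ a) := KL; rewrite !inE aK aL.
  - by move=> z zK; rewrite E !in_setD zK andbF.
  - by move=> z zL; rewrite E !in_setD zL.
  - rewrite (perm_uniq pe) /= !inE !negb_or nxy (eq_sym x u) ux (eq_sym x v) vx.
    by rewrite (eq_sym y u) uy (eq_sym y v) vy nuv.
have deg z : z \in A -> 1 < #|nbr A z| by apply: minimal_degree mA.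
have [h|] := boolP (~~ e y u && ~~ e y v).
  case/andP: h => yu yv.
  exact: (leftover_false al3 th4 cf deg (mk x y (perm_refl _) exy yu yv)).
rewrite negb_and !negbK => h.
have xu : ~~ e x u.
  by apply/negP => xu; move: h; rewrite (negPf (tri u v uin vin nuv xu))
    (negPf (mat u v uin vin nuv xu)).
have xv : ~~ e x v.
  by apply/negP => xv; move: h; rewrite (negPf (tri v u vin uin nvu xv))
    (negPf (mat v u vin uin nvu xv)).
apply: (leftover_false al3 th4 cf deg (mk y x _ _ xu xv)); last by rewrite edge_sym.
by apply/permPl/(perm_catCA [:: y] [:: x]).
Qed.

Lemma excess1_card10 A : excess 1 A -> #|A| = 10 -> exists U V,
  [/\ U :|: V = A, is_hole5 U, is_hole5 V, anticomplete U V & [disjoint U & V]].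
Proof.
move=> xA A10; have mA : minset (excess 1) A.
  apply/minsetP; split=> // B xB BA; apply/eqP; rewrite eqEcard BA A10.
  exact: gap_bound_card (@gap_bound9 G) xB.
have [cf|[K [cK KA cK3]]] := clique_free_dec 3 A.
  (* 2 theta = 11 is impossible, so there are two parts of gap 1, with five vertices each. *)
  have [|[U [V [UV pU pV aUV [cUV alUV thUV]]]]] := gallai_minimal mA cf.
    by rewrite A10; lia.
  have U1 := minset_proper mA pU; have V1 := minset_proper mA pV.
  have xU : excess 0 U by move: xA; rewrite /excess; lia.
  have xV : excess 0 V by move: xA; rewrite /excess; lia.
  have U5 := gap_bound_card (@gap_bound4 G) xU.
  have V5 := gap_bound_card (@gap_bound4 G) xV.
  have hU : is_hole5 U by apply: excess_card5 => //; lia.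
  have hV : is_hole5 V by apply: excess_card5 => //; lia.
  exists U, V; split=> //; rewrite -setI_eq0 -cards_eq0.
  by have := cardsUI U V; rewrite UV; lia.
exfalso; have [al2|al3] := leqP (al A) 2; first exact: excess1_alpha2 mA al2 A10.
have [al4|al3'] := ltnP 3 (al A).
  by apply: (excess1_alpha4 xA al4 cK KA); rewrite cardsDS // A10 cK3.
apply: (excess1_alpha3 mA A10 _ al3'); last by move: xA; rewrite /excess; lia.
have [//|[L [cL LA cL4]]] := clique_free_dec 4 A.
exfalso; apply: (excess1_hole_pendant xA al3 cL LA).
by rewrite cardsDS // A10 cL4.
Qed.

Lemma gap_bound10 : gap_bound G 10 2.
Proof. exact: gap_boundS (@gap_bound9 G). Qed.

Lemma gap_bound12 : gap_bound G 12 2.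
Proof.
move=> A0 A012; rewrite leqNgt; apply/negP => /excess_minimal[A AA0 mA].
have xA := minset_excess mA.
have {A012 AA0 A0} A12 : #|A| <= 12 by apply: leq_trans (subset_leq_card AA0) A012.
have A10 := gap_bound_card gap_bound10 xA.
have [cf|[K [cK KA cK3]]] := clique_free_dec 3 A; last first.
  have := gap_bound_card (@gap_bound9 G) (excess_D cK xA).
  by rewrite cardsDS // cK3; lia.
(* A connected A has 11 vertices, theta 6 and alpha at most 3, against R(3, 4) <= 9. Otherwise the
   parts have gaps at least 2 and 1, which needs 10 + 5 vertices. *)
have [E|[U [V [_ pU pV _ [cUV]]]]] := gallai_minimal mA cf.
  by have := ramsey49 cf; move: xA; rewrite /excess; lia.
have := minset_proper mA pU; have := minset_proper mA pV.
have := @gap_bound4 G U; have := @gap_bound4 G V.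
have := @gap_bound9 G U; have := @gap_bound9 G V.
by move: xA; rewrite /excess; lia.
Qed.

Lemma gap_bound13 : gap_bound G 13 3.
Proof. exact: gap_boundS gap_bound12. Qed.

(* A vertex dominating neither 5-hole extends stable pairs of both to a stable
   set of size five. *)
Lemma two_holes_theta A T U V : is_clique T -> U :|: V = A :\: T ->
  is_hole5 U -> is_hole5 V -> anticomplete U V -> [disjoint U & V] ->
  T \subset A -> al A <= 4 -> th A <= 6.
Proof.
move=> cT UV hU hV aUV dUV TA al4.
have dom t : t \in T -> dominates t U || dominates t V.
  move=> tT; apply/negPn/negP; rewrite negb_or => /andP[nU nV].
  have [x [y [xU yU nxy /and3P[exy tx ty]]]] := not_dominates nU.
  have [x' [y' [xV yV nxy' /and3P[exy' tx' ty']]]] := not_dominates nV.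
  have inUV z : z \in U :|: V -> z \in A /\ t != z.
    by rewrite UV inE => /andP[zT ->]; split=> //; apply: contraNneq zT => <-.
  have d z z' : z \in U -> z' \in V -> z != z'.
    by move=> zU; apply: contraTneq => <-; rewrite (disjointFr dUV).
  have [[xA dx] [yA dy]] : (x \in A /\ t != x) /\ (y \in A /\ t != y).
    by split; apply: inUV; rewrite inE ?xU ?yU.
  have [[xA' dx'] [yA' dy']] : (x' \in A /\ t != x') /\ (y' \in A /\ t != y').
    by split; apply: inUV; rewrite inE ?xV ?yV orbT.
  suff : 5 <= al A by rewrite leqNgt ltnS al4.
  apply: (@alpha_seq _ A [:: t; x; y; x'; y']) => [z|].
    rewrite !inE => /or4P[/eqP->|/eqP->|/eqP->|/orP[]/eqP->] //.
    exact: (subsetP TA).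
  rewrite /= dx dy dx' dy' tx ty tx' ty' nxy exy nxy' exy'.
  by rewrite !d // !aUV.
(* T splits into vertices dominating U and vertices dominating V, and each share is absorbed by
   three cliques covering its hole. *)
pose T1 := [set t in T | dominates t U].
have th1 : th (T1 :|: (U :|: set0)) <= #|@set0 G| + 3.
  apply: cone_theta => //; first by apply: cliqueS cT; apply/subsetP => t; rewrite inE => /andP[].
  by move=> t; rewrite inE => /andP[_ ->].
have th2 : th ((T :\: T1) :|: (V :|: set0)) <= #|@set0 G| + 3.
  apply: cone_theta => //; first exact: cliqueS (subsetDl _ _) cT.
  move=> t; rewrite !inE => /andP[nt tT]; have := dom t tT.
  by move: nt; rewrite tT /= => /negPf-> /= ->.
rewrite cards0 !setU0 in th1 th2.
have sA : A \subset (T1 :|: U) :|: ((T :\: T1) :|: V).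
  apply/subsetP => z zA; have /setP/(_ z) := UV.
  rewrite !in_setU !in_setD zA andbT.
  by case: (z \in T1); case: (z \in T); case: (z \in U); case: (z \in V).
by have := theta_subU sA; lia.
Qed.

(** Deleting a triangle would leave two separate 5-holes, so alpha would be 4 and theta 7, which
    [two_holes_theta] contradicts. Without triangles 2 theta = 14, disconnected parts requiring 10 +
    5 vertices. *)
Lemma excess2_card13 A : excess 2 A -> #|A| = 13 -> clique_free 3 A /\ th A <= 7.
Proof.
move=> xA A13; have mA : minset (excess 2) A.
  apply/minsetP; split=> // B xB BA; apply/eqP; rewrite eqEcard BA A13.
  exact: gap_bound_card gap_bound12 xB.
have [cf|[K [cK KA cK3]]] := clique_free_dec 3 A.
  split=> //; have [E|[U [V [_ pU pV _ [cUV]]]]] := gallai_minimal mA cf.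
    by move: E; rewrite A13; lia.
  have := minset_proper mA pU; have := minset_proper mA pV.
  have := @gap_bound4 G U; have := @gap_bound4 G V.
  have := @gap_bound9 G U; have := @gap_bound9 G V.
  by move: xA cUV; rewrite /excess A13; lia.
exfalso; have xD := excess_D cK xA.
have [|U [V [UV hU hV aUV dUV]]] := excess1_card10 xD.
  by rewrite cardsDS // A13 cK3.
have := alpha_anticomplete aUV dUV; have := hole5_alpha hU; have := hole5_alpha hV.
have := thetaU U V; have := hole5_theta hU; have := hole5_theta hV.
rewrite UV; have := theta_D_clique A cK; have := alpha_D A K.
have := two_holes_theta cK UV hU hV aUV dUV KA; move: xA; rewrite /excess; lia.
Qed.

Lemma triple_elements K : #|K| = 3 -> exists a b c,
  [/\ a \in K, b \in K, c \in K, [&& a != b, a != c & b != c] & K = [set a; b; c]].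
Proof.
move=> K3; have [a aK] : exists a, a \in K by apply/card_gt0P; rewrite K3.
have [b [bK ba _]] := third a a K3; have [c [cK ca cb]] := third a b K3.
exists a, b, c; split=> //; first by rewrite eq_sym ba eq_sym ca eq_sym cb.
apply/eqP; rewrite eq_sym eqEcard K3 setUC cardsU1 cards2 !inE negb_or ca cb.
by rewrite eq_sym ba /= andbT; apply/subsetP => x; rewrite !inE => /or3P[]/eqP->.
Qed.

(** Deleting a triangle leaves 13 triangle-free vertices, so any two triangles meet. A triangle
    avoiding two vertices of T passes through the third. The three such triangles meet pairwise
    outside T, in distinct vertices forming a triangle disjoint from T. *)
Lemma gap_bound16 : gap_bound G 16 3.
Proof.
move=> A0 A016; rewrite leqNgt; apply/negP => /excess_minimal[A AA0 mA].
have xA := minset_excess mA.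
have {A016 AA0 A0} A16 : #|A| <= 16 by apply: leq_trans (subset_leq_card AA0) A016.
have A13 := gap_bound_card gap_bound13 xA.
have [cf|[T [cT TA cT3]]] := clique_free_dec 3 A.
  (* A connected A has 15 vertices, theta 8 and alpha at most 4, against R(3, 5) <= 14. Otherwise
     the gaps of the parts are at least 3 and 1 or 2 and 2, which needs 13 + 5 or 10 + 10
     vertices. *)
  have [E|[U [V [_ pU pV _ [cUV]]]]] := gallai_minimal mA cf.
    by have := ramsey5_14 cf; move: xA; rewrite /excess; lia.
  have := minset_proper mA pU; have := minset_proper mA pV.
  have := @gap_bound4 G U; have := @gap_bound4 G V.
  have := @gap_bound9 G U; have := @gap_bound9 G V.
  have := gap_bound12 (A := U); have := gap_bound12 (A := V).
  by move: xA; rewrite /excess; lia.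
have cD K : is_clique K -> K \subset A -> #|A :\: K| = #|A| - #|K|.
  by move=> _ KA; rewrite cardsDS.
(* A clique of size four would leave at most 12 vertices with gap at least 3. *)
have nK K : is_clique K -> K \subset A -> #|K| < 4.
  move=> cK KA; have := gap_bound_card gap_bound12 (excess_D cK xA).
  by rewrite cD //; lia.
have {A16} A16 : #|A| = 16.
  have := gap_bound_card gap_bound12 (excess_D cT xA).
  by rewrite cD // cT3; lia.
have T13 K : is_clique K -> K \subset A -> #|K| = 3 ->
    clique_free 3 (A :\: K) /\ th (A :\: K) <= 7.
  move=> cK KA K3; apply: excess2_card13; first exact: excess_D xA.
  by rewrite cD // A16 K3.
have al4 : al A <= 4.
  have [_ t7] := T13 T cT TA cT3; have := theta_D_clique A cT.
  by move: xA; rewrite /excess; lia.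
have meet K L : is_clique K -> is_clique L -> K \subset A -> L \subset A ->
    #|K| = 3 -> #|L| = 3 -> exists2 x, x \in K & x \in L.
  move=> cK cL KA LA K3 L3; have [/clique_freeP cf _] := T13 K cK KA K3.
  case: (boolP [exists x in K, x \in L]) => [/exists_inP[x]|/exists_inPn H].
    by exists x.
  have LAK : L \subset A :\: K.
    by apply/subsetP => x xL; rewrite inE (subsetP LA) // andbT; apply: contraL xL => /H.
  by have := cf L cL LAK; rewrite L3.
have avoid u v : u \in A -> v \in A -> u != v -> exists K : {set G},
    [/\ is_clique K, K \subset A, #|K| = 3 & (u \notin K) && (v \notin K)].
  move=> uA vA uv; have uvA : [set u; v] \subset A.
    by apply/subsetP => z /set2P[]->.
  have [cf|[K [cK KA K3]]] := clique_free_dec 3 (A :\: [set u; v]).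
    have := ramsey5_14 cf; rewrite cardsDS // cards2 uv A16 => /(_ isT).
    by have := alpha_D A [set u; v]; lia.
  exists K; split=> //; first exact: subset_trans KA (subsetDl _ _).
  by apply/andP; split; apply/negP => /(subsetP KA); rewrite !inE eqxx ?orbT.
have [a [b [c [aT bT cT' /and3P[ab ac bc] defT]]]] := triple_elements cT3.
have TinA := subsetP TA; have [aA bA cA] := And3 (TinA a aT) (TinA b bT) (TinA c cT').
have through u v w : u \in T -> v \in T -> T = [set u; v; w] -> u != v ->
    exists K : {set G}, [/\ is_clique K, K \subset A, #|K| = 3, w \in K &
      (u \notin K) && (v \notin K)].
  move=> uT vT defT' uv; have [K [cK KA K3 nuv]] := avoid u v (TinA u uT) (TinA v vT) uv.
  exists K; split=> //; have [x xT xK] := meet T K cT cK TA KA cT3 K3.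
  move: xT nuv; rewrite defT' !inE => /orP[/orP[]|] /eqP E; rewrite -E xK //.
  by rewrite andbF.
have [Kc [cKc KcA Kc3 cK /andP[aKc bKc]]] := through a b c aT bT defT ab.
have defTb : T = [set a; c; b] by rewrite defT -setUA [[set b] :|: _]setUC setUA.
have [Kb [cKb KbA Kb3 bK /andP[aKb cKb']]] := through a c b aT cT' defTb ac.
have defTa : T = [set b; c; a] by rewrite defT -setUA setUC.
have [Ka [cKa KaA Ka3 aK /andP[bKa cKa']]] := through b c a bT cT' defTa bc.
have [x xKa xKb] := meet Ka Kb cKa cKb KaA KbA Ka3 Kb3.
have [y yKb yKc] := meet Kb Kc cKb cKc KbA KcA Kb3 Kc3.
have [z zKc zKa] := meet Kc Ka cKc cKa KcA KaA Kc3 Ka3.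
have out K K' w : w \in K -> w \in K' -> (a \notin K) || (a \notin K') ->
    (b \notin K) || (b \notin K') -> (c \notin K) || (c \notin K') -> w \in A -> w \in A :\: T.
  move=> wK wK' na nb nc wA; rewrite inE wA andbT defT !inE; apply/negP.
  case/orP=> [/orP[]|] /eqP E; rewrite -E wK wK' in na nb nc => //.
have xT : x \in A :\: T.
  by apply: (out Ka Kb); rewrite ?aKb ?bKa ?cKa' ?orbT // (subsetP KaA).
have yT : y \in A :\: T.
  by apply: (out Kb Kc); rewrite ?aKb ?bKc ?cKb' ?orbT // (subsetP KbA).
have zT : z \in A :\: T.
  by apply: (out Kc Ka); rewrite ?aKc ?bKc ?cKa' ?orbT // (subsetP KcA).
have nT w t : w \in A :\: T -> t \in T -> w != t.
  by rewrite inE => /andP[wT _]; apply: contraTneq => <-.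
(* Such a w would see all of T and give a clique of size four; hence x, y, z are distinct. *)
have no_common w : w \in A :\: T -> w \in Ka -> w \in Kb -> w \in Kc -> False.
  move=> wT wa wb wc; have wA : w \in A by move: wT; rewrite inE => /andP[].
  have cW : is_clique (w |: T).
    apply: cliqueU1 => // t; rewrite defT !inE => /orP[/orP[]|] /eqP->.
    - by apply: (cliqueP _ cKa) => //; apply: nT.
    - by apply: (cliqueP _ cKb) => //; apply: nT.
    - by apply: (cliqueP _ cKc) => //; apply: nT.
  have WA : w |: T \subset A by rewrite subUset sub1set wA.
  have := nK _ cW WA; rewrite cardsU1 cT3.
  by move: wT; rewrite inE => /andP[-> _].
have xy : x != y by apply/eqP => E; apply: (no_common x) => //; rewrite E.
have yz : y != z by apply/eqP => E; apply: (no_common y) => //; rewrite E.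
have xz : x != z by apply/eqP => E; apply: (no_common x) => //; rewrite E.
have [cf _] := T13 T cT TA cT3.
have exy : e x y by apply: (cliqueP _ cKb).
have exz : e x z by apply: (cliqueP _ cKa).
have := no_triangle cf xT yT zT exy exz.
by rewrite (cliqueP _ cKc).
Qed.

End UpToSixteen.

(** * Extremal graphs *)

Section WholeGraph.

Variable G : sgraph.

Lemma alpha_setT : alpha G = al [set: G].
Proof. by apply: eq_bigl => A; rewrite subsetT andbT. Qed.

Lemma covered_cover k (A : {set G}) : covered k A -> exists C : {set {set G}},
  [/\ [forall K in C, is_clique K], A \subset cover C & #|C| <= k].
Proof.
elim: k A => [|k IH] A /=.
  move=> /eqP->; exists set0; rewrite sub0set cards0; split=> //.
  by apply/forall_inP => K; rewrite inE.
case/existsP=> K /andP[cK /IH[C [/forall_inP cC AC Ck]]].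
exists (K |: C); split.
- by apply/forall_inP => L /setU1P[->|/cC].
- rewrite /cover bigcup_setU big_set1 -subDset.
  by apply: subset_trans AC _; rewrite subxx.
- by rewrite cardsU1; have := leq_b1 (K \notin C); lia.
Qed.

Lemma coverable_theta k : coverable G k -> th [set: G] <= k.
Proof.
case/existsP=> C /andP[/andP[/forall_inP cC /eqP covC] /eqP <-].
(* The empty set is inserted to serve as the absorbed clique in [clique_absorb]. *)
rewrite -covC /cover -(set0U (\bigcup_(B in C) B)) -big_enum cardE.
apply: clique_absorb; last by move=> x; rewrite inE.
  by apply/allP => K; rewrite mem_enum; apply: cC.
by apply/cliqueP => x y; rewrite inE.
Qed.

(** [coverable] asks for exactly k distinct cliques and [covered] for k peelings, possibly
    redundant; the minima agree. *)
Lemma theta_setT : theta G = th [set: G].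
Proof.
rewrite /theta; case: ex_minnP => m cm min_m; apply/eqP; rewrite eqn_leq.
rewrite coverable_theta // andbT.
have : covered (th [set: G]) [set: G] by rewrite -theta_le.
case/covered_cover=> C [cC covC Ck]; apply: leq_trans Ck; apply: min_m.
apply/existsP; exists C; rewrite eqxx andbT /is_clique_cover cC /=.
by rewrite eqEsubset subsetT.
Qed.

(** A clique cannot meet both sides, so peeling it off lowers theta on one side only. *)
Lemma theta_anticomplete (U V : {set G}) : anticomplete U V -> [disjoint U & V] ->
  th U + th V <= th (U :|: V).
Proof.
have : covered (th (U :|: V)) (U :|: V) by rewrite -theta_le.
move: (th (U :|: V)) => k; elim: k U V => [|k IH] U V.
  by rewrite /= setU_eq0 => /andP[/eqP-> /eqP->]; rewrite theta0.
move=> /= /existsP[K /andP[cK cUV]] aUV dUV.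
have aDD : anticomplete (U :\: K) (V :\: K).
  by move=> x y; rewrite !inE => /andP[_ xU] /andP[_ yV]; apply: aUV.
have dDD : [disjoint U :\: K & V :\: K].
  by apply: disjointWl (subsetDl _ _) _; apply: disjointWr (subsetDl _ _) dUV.
have := IH (U :\: K) (V :\: K); rewrite -setDUl => /(_ cUV aDD dDD).
have tU := theta_D_clique U cK; have tV := theta_D_clique V cK.
have [dU|] := boolP [disjoint U & K]; first by rewrite (setDidPl dU); lia.
rewrite -setI_eq0 => /set0Pn[x]; rewrite inE => /andP[xU xK].
have dV : [disjoint V & K].
  rewrite disjoint_subset; apply/subsetP => y yV; rewrite inE; apply/negP => yK.
  have := aUV x y xU yV; rewrite (cliqueP _ cK) //.
  by apply: contraTneq yV => <-; rewrite (disjointFr dUV).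
by rewrite (setDidPl dV); lia.
Qed.

Lemma triangle_free_theta (A : {set G}) : clique_free 3 A -> #|A| <= 2 * th A.
Proof. by case/matching_theta=> f _; apply: leq_trans; apply: leq_addr. Qed.

End WholeGraph.

(** By [gap_boundS] the gap on n + 1 vertices is at most t + 1, so [excess t] determines it
    exactly. *)
Lemma is_s_intro t n (G : sgraph) : (forall H, gap_bound H n t) ->
  #|G| = n.+1 -> excess t [set: G] -> is_s t.+1 n.+1.
Proof.
move=> bnd Gn xG; split.
  exists G => //; rewrite /gap alpha_setT theta_setT.
  have := gap_boundS (bnd G); move=> /(_ [set: G]); rewrite cardsT Gn => /(_ (leqnn _)).
  move: xG; rewrite /excess => lt le.
  have -> : th [set: G] = al [set: G] + t.+1 by lia.
  by rewrite PoszD GRing.addrAC GRing.subrr GRing.add0r.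
move=> H; rewrite /gap alpha_setT theta_setT ltnNge => gH; apply/negP => Hn.
by have := bnd H [set: H]; rewrite cardsT => /(_ Hn); lia.
Qed.

(** Exhaustive search for k pairwise related entries, keeping after each choice only the later
    entries related to it. The value is [true] when none exist, and it is small enough to be
    evaluated on the concrete graphs. *)
Fixpoint no_pairwise (T : Type) (r : rel T) k (s : seq T) : bool :=
  if k is k'.+1 then
    (fix loop s := if s is x :: s' then
       no_pairwise r k' [seq y <- s' | r x y] && loop s' else true) s
  else false.

Lemma no_pairwiseP (T : eqType) (r : rel T) k (s t : seq T) :
  no_pairwise r k s -> subseq t s -> size t = k -> ~~ pairwise r t.
Proof.
elim: k s t => [//|k IH] s [//|y t] + + [tk].
elim: s => [//|x s IHs] /= /andP[nx ns]; case: eqVneq => [-> ts|_ ts]; last exact: IHs.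
apply/negP => /andP[xt pt]; have := IH _ t nx _ tk; rewrite pt.
by rewrite subseq_filter xt ts => /(_ isT).
Qed.

Lemma pairwise_uniq_in (T : eqType) (r : rel T) (s : seq T) : uniq s ->
  {in s &, forall x y, x != y -> r x y} -> pairwise r s.
Proof.
elim: s => [//|x s IH] /= /andP[xs us] H; rewrite IH //; last first.
  by move=> y z ys zs; apply: H; rewrite inE ?ys ?zs orbT.
rewrite andbT; apply/allP => y ys; apply: H; rewrite ?inE ?eqxx ?ys ?orbT //.
by apply: contraNneq xs => ->.
Qed.

Section OrdinalGraphs.

Variables (n : nat) (adj : rel nat).

(** Symmetrising [adj] lets a table or a set of differences list each edge in one direction. *)
Definition ord_edge : rel 'I_n := fun i j => (i != j) && (adj i j || adj j i).

Lemma ord_edge_sym : symmetric ord_edge.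
Proof. by move=> i j; rewrite /ord_edge eq_sym orbC. Qed.

Lemma ord_edge_irr : irreflexive ord_edge.
Proof. by move=> i; rewrite /ord_edge eqxx. Qed.

Definition ord_graph := SGraph ord_edge_sym ord_edge_irr.

Lemma ord_graph_card : #|ord_graph| = n.
Proof. exact: card_ord. Qed.

Lemma ord_set_pairwise (r : rel nat) (S : {set ord_graph}) k :
  no_pairwise r k (iota 0 n) -> {in S &, forall i j : 'I_n, i != j -> r i j} -> #|S| < k.
Proof.
move=> nr rS; rewrite ltnNge; apply/negP => kS.
have [B /subsetP BS Bk] := @subset_of_card ord_graph _ _ kS.
have sub : subseq (map val (enum B)) (iota 0 n).
  by rewrite -val_enum_ord map_subseq // enumT; apply: filter_subseq.
have sB : size (map val (enum B)) = k by rewrite size_map -cardE.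
apply/negP/negPn: (no_pairwiseP nr sub sB).
rewrite pairwise_map; apply: pairwise_uniq_in; first exact: enum_uniq.
by move=> i j; rewrite !mem_enum => /BS iS /BS; apply: rS.
Qed.

Lemma ord_graph_alpha a :
  no_pairwise (fun i j => ~~ (adj i j || adj j i)) a.+1 (iota 0 n) ->
  al [set: ord_graph] <= a.
Proof.
move=> na; have [S [/stableP sS _ <-]] := alpha_ex [set: ord_graph].
rewrite -ltnS; apply: ord_set_pairwise na _ => i j iS jS ij.
by have := sS i j iS jS; rewrite /= /ord_edge ij.
Qed.

Lemma ord_graph_triangle_free :
  no_pairwise (fun i j => adj i j || adj j i) 3 (iota 0 n) ->
  clique_free 3 [set: ord_graph].
Proof.
move=> n3; apply/clique_freeP => K /cliqueP cK _.
apply: ord_set_pairwise n3 _ => i j iK jK ij.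
by have := cK i j iK jK ij => /andP[].
Qed.

(** A clique of a triangle-free graph covers at most two vertices, so theta is at least n / 2, which
    exceeds a + t. *)
Lemma ord_graph_excess a t :
  no_pairwise (fun i j => adj i j || adj j i) 3 (iota 0 n) ->
  no_pairwise (fun i j => ~~ (adj i j || adj j i)) a.+1 (iota 0 n) ->
  2 * (a + t) < n -> excess t [set: ord_graph].
Proof.
move=> /ord_graph_triangle_free/triangle_free_theta + /ord_graph_alpha.
by rewrite cardsT ord_graph_card /excess; lia.
Qed.

End OrdinalGraphs.

(** The difference j - i modulo n; adding n keeps the subtraction from truncating. *)
Definition circulant_adj n (D : seq nat) : rel nat :=
  fun i j => (j + n - i) %% n \in D.

Definition two_pentagons_adj : rel nat :=
  fun i j => (i %/ 5 == j %/ 5) && (j %% 5 == i.+1 %% 5).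

(* Adjacency lists of a Ramsey graph for R(3,6) = 18, found by computer search. *)
Definition ramsey36_adj : rel nat := fun i j => j \in nth [::] [::
  [:: 2; 5; 8; 11; 15]; [:: 3; 6; 8; 9; 12]; [:: 0; 7; 9; 10; 13];
  [:: 1; 4; 10; 11; 14]; [:: 3; 5; 7; 9; 12]; [:: 0; 4; 6; 10; 13];
  [:: 1; 5; 7; 11; 14]; [:: 2; 4; 6; 8; 15]; [:: 0; 1; 7; 13; 16];
  [:: 1; 2; 4; 14; 16]; [:: 2; 3; 5; 15; 16]; [:: 0; 3; 6; 12; 16];
  [:: 1; 4; 11; 13; 15]; [:: 2; 5; 8; 12; 14]; [:: 3; 6; 9; 13; 15];
  [:: 0; 7; 10; 12; 14]; [:: 8; 9; 10; 11]] i.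

(** Halving the number of vertices gives only theta at least 5; the needed 6 = 3 + 3 comes from
    rounding up on each pentagon separately. *)
Lemma two_pentagons_excess : excess 1 [set: ord_graph 10 two_pentagons_adj].
Proof.
set G := ord_graph 10 two_pentagons_adj.
have al4 : al [set: G] <= 4 by apply: ord_graph_alpha; vm_compute.
have cf : clique_free 3 [set: G] by apply: ord_graph_triangle_free; vm_compute.
pose U : {set G} := [set lshift 5 i | i : 'I_5].
pose V : {set G} := [set rshift 5 i | i : 'I_5].
have th3 (W : {set G}) : #|W| = 5 -> 3 <= th W.
  by move=> W5; have := triangle_free_theta (clique_freeS (subsetT W) cf); lia.
have U5 : #|U| = 5 by rewrite card_imset ?card_ord //; apply: lshift_inj.
have V5 : #|V| = 5 by rewrite card_imset ?card_ord // => i j; apply: (@rshift_inj 5 5).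
have dUV : [disjoint U & V].
  rewrite disjoint_subset; apply/subsetP => x /imsetP[i _ ->]; rewrite inE.
  apply/negP => /imsetP[j _ /(congr1 val)] /=; have := ltn_ord i; lia.
have aUV : anticomplete U V.
  move=> x y /imsetP[i _ ->] /imsetP[j _ ->].
  rewrite /= /ord_edge /two_pentagons_adj /=.
  by rewrite divn_small // divnDl // divnn divn_small //= andbF.
have := theta_anticomplete aUV dUV; have := thetaS (subsetT (U :|: V)).
by have := th3 U U5; have := th3 V V5; rewrite /excess; lia.
Qed.

Theorem mainTheorem1 :
  [/\ is_s 1 5, is_s 2 10, is_s 3 13 & is_s 4 17].
Proof.
split.
- apply: (is_s_intro gap_bound4 (ord_graph_card 5 (circulant_adj 5 [:: 1]))).
  by apply: (@ord_graph_excess _ _ 2); vm_compute.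
- apply: (is_s_intro gap_bound9 (ord_graph_card 10 two_pentagons_adj)).
  exact: two_pentagons_excess.
(* The differences 1, 5 and their negatives 8, 12 are the cubic residues modulo 13; this circulant
   is the Ramsey graph for R(3, 5) = 14. The constant 4 below bounds its stability number, and 2 *
   (4 + 2) < 13. *)
- apply: (is_s_intro gap_bound12 (ord_graph_card 13 (circulant_adj 13 [:: 1; 5]))).
  by apply: (@ord_graph_excess _ _ 4); vm_compute.
- apply: (is_s_intro gap_bound16 (ord_graph_card 17 ramsey36_adj)).
  by apply: (@ord_graph_excess _ _ 5); vm_compute.
Qed.
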